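(* Suppose that all honest sensors are affected by the change ($\mathcal{B}=\mathcal{N}$) and that $|\mathcal{N}| = K-M = M+1$. Then the $(M+1)$-alarm, $\tau_{(M+1)}$, dominates the voting rule, $T_{M+1}$, and the latter dominates Low-Sum-CUSUM, $\widetilde{T}_{M+1}$.
   Context: Setting. There are $K$ sensors, indexed by $[K]=\{1,\ldots,K\}$; $\mathbb{N}=\{1,2,\ldots\}$; $M\ge 0$ is an integer with $M<K$. An arbitrary fixed subset $\mathcal{N}\subseteq[K]$ of size $|\mathcal{N}|=K-M$ consists of honest sensors; the remaining $M$ sensors are corrupt. $X_t^k$ is the observation of sensor $k$ at time $t\in\mathbb{N}$. $f,g$ are known densities with respect to a $\sigma$-finite measure $\lambda$, with $0<\mathcal{I}:=\int \log(g/f)\,g\,d\lambda<\infty$. The change occurs at a deterministic time $\nu\in\{0,1,\ldots\}$ in a subset $\mathcal{B}\subseteq\mathcal{N}$ (the affected sensors): the variables $X_t^k$, $k\in\mathcal{N}$, $t\in\mathbb{N}$, are independent, and $X_t^k$ has density $g$ if $k\in\mathcal{B}$ and $t>\nu$, and density $f$ otherwise. Adversary. A strategy is a family $\pi=\{\pi_t\}_{t\in\mathbb{N}}$ of deterministic Borel functions (which may depend on $\mathcal{N},\nu,\mathcal{B}$) such that the corrupt observations at time $t$ are $(X_t^k)_{k\notin\mathcal{N}}=\pi_t\big((X_s^j)_{j\in\mathcal{N},\,1\le s\le t}\big)$. $\mathsf{P}_\nu^{\mathcal{B},\pi}$ is the resulting probability measure, and $\mathsf{P}_\infty^{\pi}$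 is the measure when no change ever occurs in the honest sensors; expectations are $\mathsf{E}_\nu^{\mathcal{B},\pi}$, $\mathsf{E}_\infty^\pi$. Criteria. $\mathcal{F}_t=\sigma(X_s^k:1\le s\le t,\,k\in[K])$. A detection rule is an $\{\mathcal{F}_t\}$-stopping time $T$. Its worst-case detection delay and worst-case expected time to false alarm are $$\mathcal{J}_{\mathcal{B}}[T]=\sup_{\nu,\pi}\ \operatorname{ess\,sup}\ \mathsf{E}_\nu^{\mathcal{B},\pi}[(T-\nu)^+\mid\mathcal{F}_\nu],\qquad \mathcal{A}[T]=\inf_\pi \mathsf{E}_\infty^\pi[T].$$ Local CUSUM statistics. $\ell_t^k=\log\big(g(X_t^k)/f(X_t^k)\big)$, $Y_0^k=0$, $Y_t^k=(Y_{t-1}^k+\ell_t^k)^+$ for $k\in[K]$, where $x^+=\max\{x,0\}$, and $Y_t^{(1)}\le\cdots\le Y_t^{(K)}$ are the ordered values at time $t$. Rules. For a threshold $h>0$, $\tau_k(h)=\inf\{t\in\mathbb{N}:Y_t^k\ge h\}$, and $\tau_{(1)}(h)\le\cdots\le\tau_{(K)}(h)$ are the ordered values of $\tau_1(h),\ldots,\tau_K(h)$; the $L$th alarm is $\tau_{(L)}(h)$. The voting rule is $T_L(h)=\inf\{t\in\mathbb{N}:Y_t^{(K-L+1)}\ge h\}$. Low-Sum-CUSUM is $\widetilde{T}_L(h)=\inf\{t\in\mathbb{N}:\sum_{k=1}^L Y_t^{(k)}\ge h\}$. The symbols $\tau_{(L)}$, $T_L$, $\widetilde{T}_L$ denote these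 rules with the threshold suppressed. Domination. For two detection rules $T$ and $S$, $S$ dominates $T$ if $\mathcal{J}_{\mathcal{B}}[T]\ge\mathcal{J}_{\mathcal{B}}[S]$ for every $\mathcal{B}\subseteq\mathcal{N}$ with $M+1\le|\mathcal{B}|\le K-M$ whenever $\mathcal{A}[T]\le\mathcal{A}[S]$. The ordering of the three rules is understood for any given false alarm rate: the rules are compared at the same value of $\mathcal{A}$, each with its own threshold, and the thresholds may differ from rule to rule.
   Formalization: When false alarm rate does not fix the threshold, voting with threshold h can fail to dominate Low-Sum-CUSUM with a smaller h' at equal rate; that half is stated for h ≤ h' (all pairs if the rate fixes the threshold), and otherwise for a suitable equal-rate threshold of either rule. *)

(* Defs.v *)
From HB Require Import structures.
From mathcomp Require Import all_boot all_order all_algebra.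
From mathcomp Require Import all_classical all_reals all_analysis.
From mathcomp Require Import measurable_realfun ess_sup_inf.

Set Implicit Arguments.
Unset Strict Implicit.
Unset Printing Implicit Defensive.

Import Order.TTheory GRing.Theory Num.Theory.
Import numFieldNormedType.Exports.

Local Open Scope classical_set_scope.
Local Open Scope ring_scope.
Local Open Scope ereal_scope.

(** Times are natural numbers starting at 1: an observation path is a function
    [x : 'I_K -> nat -> E] of which the values [x k 0] are never used. *)

Section Densities.
Context (R : realType) (d : measure_display) (E : measurableType d).
Variable lam : {measure set E -> \bar R}.

Definition is_density (f : E -> R) : Prop :=
  [/\ measurable_fun setT f, (forall x, (0 <= f x)%R)
    & \int[lam]_x (f x)%:E = 1].

(** [log (g/f)] in the extended reals: [-oo] where [g] vanishes, [+oo] where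
    only [f] does. *)
Definition llr (f g : E -> R) (x : E) : \bar R := lne ((g x)%:E / (f x)%:E).

Definition KL_information (f g : E -> R) : \bar R :=
  \int[lam]_x (llr f g x * (g x)%:E).

End Densities.

Section Probability.
Context (R : realType) (d d' : measure_display).
Context (W : measurableType d') (E : measurableType d).

Definition mutually_independent (I : eqType) (P : probability W R)
    (D : set I) (Y : I -> W -> E) : Prop :=
  forall (s : seq I) (A : I -> set E), uniq s ->
    (forall i, i \in s -> D i /\ measurable (A i)) ->
    P (\bigcap_(i in [set` s]) (Y i @^-1` A i)) =
    \prod_(i <- s) P (Y i @^-1` A i).

(** [Z] is a version of the conditional expectation of the nonnegative extended
    random variable [Y] given the sub-sigma-algebra [F]; as [F] is a
    sigma-algebra, the measurable sets of [g_sigma_algebraType F] are those of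
    [F]. *)
Definition is_cond_exp (P : probability W R) (F : set (set W))
    (Y Z : W -> \bar R) : Prop :=
  [/\ forall w, 0 <= Z w,
      measurable_fun setT (Z : g_sigma_algebraType F -> \bar R)
    & forall A, F A -> \int[P]_(w in A) Z w = \int[P]_(w in A) Y w].

End Probability.

Section Rules.
Context (R : realType) (d : measure_display) (E : measurableType d).
Variables (f g : E -> R) (K : nat).

(** A detection rule is given as a functional of the path observed so far by all
    the sensors, with values in the positive integers or [+oo]. *)
Definition rule := ('I_K -> nat -> E) -> \bar R.

Fixpoint cusum (x : nat -> E) (t : nat) : \bar R :=
  if t is t'.+1 then maxe (cusum x t' + llr f g (x t'.+1)) 0 else 0.

(** [order_stat a i] is the [i]-th smallest of the [K] values of [a], for
    [1 <= i <= K]. *)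
Definition order_stat (a : 'I_K -> \bar R) (i : nat) : \bar R :=
  nth 0 (sort <=%O [seq a k | k : 'I_K]) i.-1.

(** Infimum of a set of positive times; it is [+oo] if there is none. *)
Definition first_time (p : nat -> Prop) : \bar R :=
  ereal_inf [set (t%:R)%:E | t in [set t : nat | (0 < t)%N /\ p t]].

Definition local_alarm (h : R) (x : nat -> E) : \bar R :=
  first_time (fun t => h%:E <= cusum x t).

Definition Lth_alarm (L : nat) (h : R) : rule := fun x =>
  order_stat (fun k => local_alarm h (x k)) L.

Definition voting (L : nat) (h : R) : rule := fun x =>
  first_time (fun t => h%:E <= order_stat (fun k => cusum (x k) t) (K - L + 1)).

Definition low_sum_cusum (L : nat) (h : R) : rule := fun x =>
  first_time (fun t =>
    h%:E <= \sum_(1 <= i < L.+1) order_stat (fun k => cusum (x k) t) i).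

End Rules.

Section Adversary.
Context (d : measure_display) (E : measurableType d).
Variables (K : nat) (N : {set 'I_K}).

(** The honest observations up to time [t]: component [s : 'I_t] of the outer
    tuple is taken at time [s + 1], and its component [j] is that of the [j]-th
    honest sensor. *)
Definition honest_history (t : nat) (x : 'I_K -> nat -> E) :
    t.-tuple (#|N|.-tuple E) :=
  [tuple [tuple x (enum_val j) s.+1 | j < #|N|] | s < t].

(** [act (t := t) k] produces the observation of the corrupt sensor [k] at time [t];
    it plays no role for [k \in N]. *)
Record strategy := Strategy {
  act : forall t : nat, 'I_K -> t.-tuple (#|N|.-tuple E) -> E;
  act_measurable : forall t k, measurable_fun setT (@act t k) }.

Definition observed (pi : strategy) (x : 'I_K -> nat -> E) : 'I_K -> nat -> E :=
  fun k t => if k \in N then x k t else act pi k (honest_history t x).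

End Adversary.

Section Criteria.
Context (R : realType) (d d' : measure_display).
Context (E : measurableType d) (W : measurableType d').
Variables (K M : nat) (N : {set 'I_K}) (X : 'I_K -> nat -> W -> E).
(** [Pinf] governs the honest observations when there is no change and [P nu B]
    when the change occurs at time [nu] in the sensors of [B]. A strategy [pi]
    turns the honest observations into those of all [K] sensors on the same
    space, so that the laws under [pi] are those of [observations pi]. *)
Variables (Pinf : probability W R) (P : nat -> {set 'I_K} -> probability W R).

Definition observations (pi : strategy E N) (w : W) : 'I_K -> nat -> E :=
  observed pi (fun k t => X k t w).

Definition filtration (pi : strategy E N) (t : nat) : set (set W) :=
  <<s [set A | exists k s (C : set E), [/\ (1 <= s <= t)%N, measurable C
         & A = (fun w => observations pi w k s) @^-1` C]] >>.

Definition delay (B : {set 'I_K}) (T : rule R E K) : \bar R :=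
  ereal_sup [set y | exists (nu : nat) (pi : strategy E N) (Z : W -> \bar R),
    is_cond_exp (P nu B) (filtration pi nu)
      (fun w => maxe (T (observations pi w) - (nu%:R)%:E) 0) Z /\
    y = ess_sup (P nu B) Z].

Definition time_to_false_alarm (T : rule R E K) : \bar R :=
  ereal_inf [set \int[Pinf]_w T (observations pi w) | pi in [set: strategy E N]].

(** The bounds on [#|B|] leave only [B = N] when [#|N| = K - M = M + 1]. *)
Definition dominates (S T : rule R E K) : Prop :=
  time_to_false_alarm T <= time_to_false_alarm S ->
  forall B : {set 'I_K}, B \subset N -> (M + 1 <= #|B| <= K - M)%N ->
    delay B S <= delay B T.

End Criteria.

Section Model.
Context (R : realType) (d d' : measure_display).
Context (E : measurableType d) (W : measurableType d').
Variables (lam : {measure set E -> \bar R}) (f g : E -> R).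
Variables (K : nat) (N : {set 'I_K}) (X : 'I_K -> nat -> W -> E).

(** The observations of the sensors in [N] are independent, with density [g] at
    the pairs (sensor, time) selected by [changed] and [f] at the others. *)
Definition honest_law (changed : 'I_K -> nat -> bool) (Q : probability W R) :
    Prop :=
  mutually_independent Q [set i : 'I_K * nat | (i.1 \in N) && (0 < i.2)%N]
    (fun i => X i.1 i.2) /\
  forall k t (A : set E), k \in N -> (0 < t)%N -> measurable A ->
    Q (X k t @^-1` A) =
    \int[lam]_(x in A) ((if changed k t then g else f) x)%:E.

Definition no_change (k : 'I_K) (t : nat) : bool := false.

Definition change_at (nu : nat) (B : {set 'I_K}) (k : 'I_K) (t : nat) : bool :=
  (k \in B) && (nu < t)%N.

End Model.

(* Main.v *)
From HB Require Import structures.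
Require Import Defs.
From mathcomp Require Import all_boot all_order all_algebra.
From mathcomp Require Import all_classical all_reals all_analysis.
From mathcomp Require Import measurable_realfun ess_sup_inf.
Import Order.TTheory GRing.Theory Num.Theory.
Import numFieldNormedType.Exports.
Set Implicit Arguments.
Unset Strict Implicit.
Unset Printing Implicit Defensive.
Local Open Scope classical_set_scope.
Local Open Scope ring_scope.
Local Open Scope ereal_scope.

(** Write [n = M + 1] for the number of honest sensors, which is one more than
    the number of corrupt ones. Each rule is replaced by a rule of the honest
    sensors alone that it reduces to under the worst adversary.

    Before the change the adversary wants early alarms. By copying at every step
    the honest observation with the largest log-likelihood ratio, it keeps all
    the corrupt statistics above all the honest ones ([greedy_leads]). The
    [n]-th alarm and the voting rule then both stop with the first honest alarm,
    and Low-Sum-CUSUM when the sum of the honest statistics reaches the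
    threshold; no strategy does better ([far_tau], [far_vote], [far_lowsum]).

    After the change the adversary wants late alarms. By always sending an
    observation that is no more likely under [g] than under [f], it keeps the
    corrupt statistics at [0] ([constant_silent]). Voting and Low-Sum-CUSUM then
    both wait until all the honest statistics are above the threshold at the same
    time. Under any strategy, voting stops by then, and the [n]-th alarm stops
    by the last of the local alarms of the honest sensors. To pass from such
    pointwise comparisons of stopping times to delays, one needs that all the
    strategies generate the same filtration ([sub_filtration]) and that
    conditional expectations exist and are monotone ([cond_exp_exists],
    [le_cond_exp]); this is [le_delay].

    If the dominating rule has the smaller threshold, its delay is therefore the
    smaller one. For voting against Low-Sum-CUSUM this is enough: the sum of the
    honest statistics reaches a threshold no later than any single one of them,
    so that when voting has the larger threshold a squeeze shows that each of the
    two rules has the same false alarm rate at both thresholds, and can be given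
    the threshold of the other one.

    The remaining case is the [n]-th alarm with threshold [h] against voting with
    [h' < h]. Equality of the false alarm rates says that the first honest alarm
    has the same mean for both thresholds. This mean is finite, because a long
    enough run of large log-likelihood ratios triggers an alarm and the waiting
    time for such a run is at most geometric ([run_waiting_time],
    [first_honest_alarm_integrable]); hence the two first alarms agree almost
    surely. As the other sensors may stay silent, independently and with
    positive probability, almost surely no single statistic can reach [h']
    before [h]. Absolute continuity of the law of a sensor after the change with
    respect to its law without a change, a consequence of finite information,
    carries this over to all the laws with a change ([stops_short_null]), under
    which the local alarms therefore do not distinguish [h] from [h']. *)

(** * Order statistics *)

Section OrderStatistics.
Context (R : realType) (K : nat).
Implicit Types (a : 'I_K -> \bar R) (A : {set 'I_K}) (i : nat) (x : \bar R).

Let values a := sort <=%O [seq a k | k : 'I_K].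

Let sorted_values a : sorted <=%O (values a).
Proof. exact/sort_sorted/le_total. Qed.

Let size_values a : size (values a) = K.
Proof. by rewrite size_sort size_map size_enum_ord. Qed.

Let count_values a (p : pred \bar R) : count p (values a) = #|[pred k | p (a k)]|.
Proof.
rewrite (permP (permEl (perm_sort _ _))) count_map -sum1_count big_enum_cond.
by rewrite sum1_card; apply: eq_card => k; rewrite !inE.
Qed.

Lemma le_order_stat a i x : (0 < i <= K)%N ->
  (#|[pred k | (a k < x)%E]| < i)%N -> x <= order_stat a i.
Proof.
case: i => // i /= iK ai; apply: nth_count_ge => //.
by rewrite size_values iK count_values andbT.
Qed.

Lemma order_stat_le a i x : (i < #|[pred k | (a k <= x)%E]|)%N ->
  order_stat a i.+1 <= x.
Proof. by move=> ai; apply: nth_count_le (sorted_values a) _; rewrite count_values. Qed.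

Lemma lt_order_stat a i x : (i < #|[pred k | (a k < x)%E]|)%N ->
  order_stat a i.+1 < x.
Proof. by move=> ai; apply: nth_count_lt (sorted_values a) _; rewrite count_values. Qed.

Let values_in a A := sort <=%O [seq a k | k in A].

Let size_values_in a A : size (values_in a A) = #|A|.
Proof. by rewrite size_sort size_map -cardE. Qed.

Let count_values_in a A (p : pred \bar R) :
  count p (values_in a A) = #|[pred k in A | p (a k)]|.
Proof.
rewrite (permP (permEl (perm_sort _ _))) count_map -sum1_count big_enum_cond.
by rewrite sum1_card; apply: eq_card => k; rewrite !inE.
Qed.

Let sum_values_in a A :
  \sum_(k in A) a k = \sum_(1 <= i < #|A|.+1) nth 0 (values_in a A) i.-1.
Proof.
rewrite big_add1 /= -(size_values_in a) -(big_nth 0 xpredT id).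
by rewrite (perm_big _ (permEl (perm_sort _ _))) big_map big_enum.
Qed.

(** The [i]-th smallest value over [A] has at least [i] values of [A] below or
    equal to it, hence at least [i] values overall. *)
Lemma sum_order_stat_le a A :
  \sum_(1 <= i < #|A|.+1) order_stat a i <= \sum_(k in A) a k.
Proof.
rewrite sum_values_in big_nat_cond [leRHS]big_nat_cond.
apply: lee_sum => -[|i] // /andP[/andP[_ iA] _] /=.
apply: order_stat_le; rewrite ltnS in iA.
set x := nth _ _ _.
suff : (i < count (<= x)%O (values_in a A))%N.
  rewrite count_values_in => /leq_trans; apply.
  by apply/subset_leq_card/fintype.subsetP => k; rewrite !inE => /andP[].
rewrite ltnNge; apply/negP => xi.
suff : x < x by rewrite ltxx.
by apply: nth_count_gt; rewrite ?sort_sorted ?size_values_in ?xi//; exact: le_total.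
Qed.

(** Here the [i]-th smallest value over [A] is also the [i]-th smallest overall:
    no value outside [A] is below it. *)
Lemma sum_le_order_stat a A :
  (forall k j, k \notin A -> j \in A -> a j <= a k) ->
  \sum_(k in A) a k <= \sum_(1 <= i < #|A|.+1) order_stat a i.
Proof.
move=> ale; rewrite sum_values_in big_nat_cond [leRHS]big_nat_cond.
apply: lee_sum => -[|i] // /andP[/andP[_ iA] _] /=.
rewrite ltnS in iA.
set x := nth _ _ _.
apply: le_order_stat => /=.
  by rewrite (leq_trans iA)// -[leqRHS]card_ord max_card.
rewrite ltnS leqNgt; apply/negP => xi.
suff : x < x by rewrite ltxx.
have [j jA xE] : exists2 j, j \in A & x = a j.
  have : x \in values_in a A by apply: mem_nth; rewrite size_values_in.
  by rewrite mem_sort => /mapP[j]; rewrite mem_enum => jA ->; exists j.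
apply: nth_count_lt; first exact/sort_sorted/le_total.
rewrite count_values_in; apply: (leq_trans xi).
apply/subset_leq_card/fintype.subsetP => k; rewrite !inE => akx.
rewrite akx andbT; apply: contraLR akx => kA.
by rewrite -leNgt xE ale.
Qed.

End OrderStatistics.

(** * The rules on a fixed path *)

Section FirstTime.
Context (R : realType).
Implicit Types (p q : nat -> Prop) (y : \bar R).

Lemma first_time_le p t : (0 < t)%N -> p t -> first_time R p <= t%:R%:E.
Proof. by move=> t0 pt; apply: ereal_inf_lbound; exists t. Qed.

Lemma le_first_time p y :
  (forall t, (0 < t)%N -> p t -> y <= t%:R%:E) -> y <= first_time R p.
Proof. by move=> yp; apply/ereal_infP => _ [t [t0 pt] <-]; exact: yp. Qed.

Lemma first_time_ge0 p : 0 <= first_time R p.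
Proof. by apply: le_first_time => t _ _; rewrite lee_fin. Qed.

Lemma sub_first_time p q : (forall t, (0 < t)%N -> q t -> p t) ->
  first_time R p <= first_time R q.
Proof.
move=> qp; apply: le_first_time => t t0 qt.
exact: (first_time_le t0 (qp t t0 qt)).
Qed.

End FirstTime.

Section Cusum.
Context (R : realType) (d : measure_display) (E : measurableType d).
Variables (f g : E -> R).

Lemma cusum_ge0 x t : 0 <= cusum f g x t.
Proof. by case: t => [|t] //=; rewrite le_max lexx orbT. Qed.

Lemma le_cusum x y t :
  (forall s, (0 < s <= t)%N -> llr f g (x s) <= llr f g (y s)) ->
  cusum f g x t <= cusum f g y t.
Proof.
elim: t => // t IH xy /=; rewrite ge_max le_max le_max lexx orbT andbT.
rewrite leeD ?xy ?ltnSn// IH// => s /andP[s0 st].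
by rewrite xy// s0 ltnW.
Qed.

Lemma cusum_eq0 x t :
  (forall s, (0 < s <= t)%N -> llr f g (x s) <= 0) -> cusum f g x t = 0.
Proof.
elim: t => // t IH xy /=; rewrite IH => [|s /andP[s0 st]].
  by apply/max_idPr; rewrite add0e xy ?ltnSn.
by rewrite xy// s0 ltnW.
Qed.

End Cusum.

Section Paths.
Context (R : realType) (d : measure_display) (E : measurableType d).
Variables (f g : E -> R) (K M : nat) (N : {set 'I_K}).
Hypotheses (NE : #|N| = M.+1) (KE : K = (M + M.+1)%N).
Implicit Types (h : R) (x : 'I_K -> nat -> E).

Definition first_honest_alarm h : rule R E K := fun x =>
  first_time R (fun t => exists2 j, j \in N & h%:E <= cusum f g (x j) t).

Definition joint_honest_alarm h : rule R E K := fun x =>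
  first_time R (fun t => forall j, j \in N -> h%:E <= cusum f g (x j) t).

Definition sum_honest_alarm h : rule R E K := fun x =>
  first_time R (fun t => h%:E <= \sum_(j in N) cusum f g (x j) t).

Let tau := Lth_alarm f g (K := K) (M + 1).
Let vote := voting f g (K := K) (M + 1).
Let lowsum := low_sum_cusum f g (K := K) (M + 1).

Let vote_rank : (K - (M + 1) + 1)%N = M.+1.
Proof. by rewrite !addn1 [X in (X - _)%N]KE addnK. Qed.

Let ltMK : (M < K)%N. Proof. by rewrite [ltnRHS]KE leq_addl. Qed.

Let card_notin : #|[pred k | k \notin N]| = M.
Proof.
have : (#|N| + #|[predC N]| = M.+1 + M)%N by rewrite cardC card_ord addnC.
by rewrite NE => /addnI <-; apply: eq_card => k; rewrite !inE.
Qed.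

Lemma first_honest_alarm_le_Lth_alarm h x : first_honest_alarm h x <= tau h x.
Proof.
apply: le_order_stat; first by rewrite addn1.
rewrite addn1 ltnS -card_notin; apply/subset_leq_card/fintype.subsetP => k.
rewrite !inE; apply: contraL => kN; rewrite -leNgt.
by apply: sub_first_time => t _ hk; exists k.
Qed.

(** Sensors that vote together have raised their local alarms by then. *)
Lemma Lth_alarm_le_voting h x : tau h x <= vote h x.
Proof.
apply: le_first_time => t t0 ht; rewrite /tau /Lth_alarm addn1.
apply: order_stat_le; rewrite ltnNge; apply/negP => small.
move: ht; rewrite leNgt => /negP; apply.
rewrite vote_rank.
set A := [pred k | _] in small.
apply: lt_order_stat; apply: (@leq_trans #|[predC A]|); last first.
  apply/subset_leq_card/fintype.subsetP => k; rewrite !inE.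
  by apply: contraR; rewrite -leNgt; exact: first_time_le.
have AC : (#|A| + #|[predC A]| = K)%N by rewrite cardC card_ord.
by rewrite -(ltn_add2l #|A|) AC [ltnRHS]KE addnS ltnS leq_add2r.
Qed.

Lemma voting_le_joint_honest_alarm h x : vote h x <= joint_honest_alarm h x.
Proof.
apply: sub_first_time => t _ ht; rewrite vote_rank.
apply: le_order_stat; first exact: ltMK.
rewrite ltnS -card_notin; apply/subset_leq_card/fintype.subsetP => k.
by rewrite !inE; apply: contraL => kN; rewrite -leNgt ht.
Qed.

Lemma Lth_alarm_le h x y : (forall j, j \in N -> local_alarm f g h (x j) <= y) ->
  tau h x <= y.
Proof.
move=> xy; rewrite /tau /Lth_alarm addn1; apply: order_stat_le.
rewrite -NE; apply/subset_leq_card/fintype.subsetP => k kN.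
by rewrite inE xy.
Qed.

Lemma sum_honest_alarm_le_low_sum h x : sum_honest_alarm h x <= lowsum h x.
Proof.
apply: sub_first_time => t _ /le_trans; apply.
by rewrite addn1 -NE; exact: sum_order_stat_le.
Qed.

Lemma sum_honest_alarm_le_first_honest_alarm h x :
  sum_honest_alarm h x <= first_honest_alarm h x.
Proof.
apply: sub_first_time => t _ [j jN] /le_trans; apply.
by rewrite (bigD1 j)//= leeDl// sume_ge0// => k _; exact: cusum_ge0.
Qed.

Lemma low_sum_le_voting h x : lowsum h x <= vote h x.
Proof.
apply: sub_first_time => t _; rewrite vote_rank addn1 => /le_trans; apply.
rewrite big_nat_recr//= leeDr// big_nat_cond sume_ge0// => i.
move=> /andP[/andP[i0 iM] _]; apply: le_order_stat.
  by rewrite i0 (leq_trans (ltnW iM) ltMK).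
by rewrite eq_card0// => k; rewrite !inE ltNge cusum_ge0.
Qed.

(** Corrupt statistics above all the honest ones: a single honest vote completes
    a majority, and the smallest statistics are those of the honest sensors. *)
Section Leading.
Variable x : 'I_K -> nat -> E.
Hypothesis leading : forall k j t, k \notin N -> j \in N ->
  cusum f g (x j) t <= cusum f g (x k) t.

Lemma voting_leading h : vote h x = first_honest_alarm h x.
Proof.
apply/eqP; rewrite eq_le; apply/andP; split; last first.
  exact: le_trans (first_honest_alarm_le_Lth_alarm h x) (Lth_alarm_le_voting h x).
apply: sub_first_time => t _ [j jN hj]; rewrite vote_rank.
apply: le_order_stat; first exact: ltMK.
have -> : M = #|N :\ j| by move: NE; rewrite (cardsD1 j) jN => -[].
rewrite ltnS; apply/subset_leq_card/fintype.subsetP => k; rewrite !inE => hk.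
have kj : k != j by apply: contraTneq hk => ->; rewrite -leNgt.
rewrite kj /=; apply: contraTT hk => kN; rewrite -leNgt.
exact: le_trans hj (leading t kN jN).
Qed.

Lemma low_sum_leading h : lowsum h x = sum_honest_alarm h x.
Proof.
apply/eqP; rewrite eq_le sum_honest_alarm_le_low_sum andbT.
apply: sub_first_time => t _ /le_trans; apply.
by rewrite addn1 -NE; apply: sum_le_order_stat => k j; exact: leading.
Qed.

End Leading.

(** Corrupt statistics equal to zero: a majority needs all the honest sensors. *)
Section Silent.
Variable x : 'I_K -> nat -> E.
Hypothesis silent : forall k t, k \notin N -> cusum f g (x k) t = 0.

(** The smallest [M + 1] statistics have at most the sum of those of the corrupt
    sensors and of one honest sensor, of which only the last one counts. *)
Lemma low_sum_silent h : lowsum h x = joint_honest_alarm h x.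
Proof.
apply/eqP; rewrite eq_le; apply/andP; split.
  exact: le_trans (low_sum_le_voting h x) (voting_le_joint_honest_alarm h x).
apply: sub_first_time => t _ ht j jN.
have NjE : #|j |: ~: N| = M.+1.
  rewrite cardsU1 inE jN /=; congr _.+1; rewrite -card_notin.
  by apply: eq_card => k; rewrite !inE.
apply: (le_trans ht); rewrite addn1 -NjE.
apply: le_trans (sum_order_stat_le _ _) _.
rewrite (bigD1 j)/= ?inE ?eqxx ?orbT// big1 ?adde0// => k.
rewrite !inE => /andP[/orP[/eqP-> |kN _]]; first by rewrite eqxx.
exact: silent.
Qed.

Lemma voting_silent h : vote h x = joint_honest_alarm h x.
Proof.
apply/eqP; rewrite eq_le voting_le_joint_honest_alarm /=.
by rewrite -low_sum_silent// low_sum_le_voting.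
Qed.

End Silent.

Lemma le_first_honest_alarm h h' x : (h <= h')%R ->
  first_honest_alarm h x <= first_honest_alarm h' x.
Proof.
move=> hh; apply: sub_first_time => t _ [j jN hj]; exists j => //.
by apply: le_trans hj; rewrite lee_fin.
Qed.

Lemma le_sum_honest_alarm h h' x : (h <= h')%R ->
  sum_honest_alarm h x <= sum_honest_alarm h' x.
Proof.
move=> hh; apply: sub_first_time => t _; apply: le_trans.
by rewrite lee_fin.
Qed.

Lemma le_joint_honest_alarm h h' x : (h <= h')%R ->
  joint_honest_alarm h x <= joint_honest_alarm h' x.
Proof.
move=> hh; apply: sub_first_time => t _ hj j /hj; apply: le_trans.
by rewrite lee_fin.
Qed.

End Paths.

(** * Comparison of integrals *)

Section IntegralComparison.
Context (R : realType) (d : measure_display) (T : measurableType d).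
Variable mu : {measure set T -> \bar R}.
Implicit Types (D : set T) (u v : T -> \bar R).

(** The integral of a nonnegative function is a supremum over the simple
    functions below it, whether or not it is measurable. *)
Lemma le_integral_nonneg D u v :
  (forall x, 0 <= u x) -> (forall x, u x <= v x) ->
  \int[mu]_(x in D) u x <= \int[mu]_(x in D) v x.
Proof.
move=> u0 uv; have v0 x : 0 <= v x by exact: le_trans (uv x).
rewrite !ge0_integralE//; apply/ge_ereal_sup => _ [s su <-]; apply: ereal_sup_ubound.
exists s => // x /=; apply: le_trans (su x) _; rewrite !patchE.
by case: ifP.
Qed.

Let eq_integral_null_fin D u v :
  measurable D -> measurable_fun D u -> measurable_fun D v ->
  (forall x, D x -> 0 <= u x < +oo) -> (forall x, D x -> u x <= v x) ->
  \int[mu]_(x in D) u x < +oo ->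
  \int[mu]_(x in D) v x <= \int[mu]_(x in D) u x ->
  mu.-negligible [set x | D x /\ u x <> v x].
Proof.
move=> mD mU mV u0 uv uoo vu.
have ufn x : D x -> u x \is a fin_num.
  by move=> /u0/andP[ux0 uxoo]; rewrite ge0_fin_numE.
have vu0 x : D x -> 0 <= v x - u x.
  by move=> Dx; rewrite sube_ge0 ?uv ?ufn.
have mvu : measurable_fun D (fun x => v x - u x) by exact: emeasurable_funB.
have ufin : \int[mu]_(x in D) u x \is a fin_num.
  by rewrite ge0_fin_numE//; apply: integral_ge0 => x /u0/andP[].
have gap0 : \int[mu]_(x in D) (v x - u x) = 0.
  apply/eqP; rewrite eq_le integral_ge0// andbT.
  rewrite -(leeD2lE _ _ ufin) adde0; apply: le_trans vu.
  rewrite -ge0_integralD//; last by move=> x /u0/andP[].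
  rewrite le_eqVlt; apply/orP; left; apply/eqP/eq_integral => x /set_mem Dx.
  by rewrite [LHS]addeC subeK// ufn.
have gap0' : \int[mu]_(x in D) `|v x - u x| = 0.
  by rewrite -gap0; apply: eq_integral => x /set_mem Dx; rewrite gee0_abs// vu0.
have [C [mC C0 DC]] := (ae_eq_integral_abs mu mD mvu).1 gap0'.
exists C; split => // x [Dx uvx]; apply: DC => /= /(_ Dx) vux; apply: uvx.
by rewrite -(subeK (v x) (ufn x Dx)) vux add0e.
Qed.

(** Where [u] is infinite so is [v], and the integrals over this set cancel;
    elsewhere [v - u] is nonnegative with integral zero. *)
Lemma eq_integral_null D u v :
  measurable D -> measurable_fun D u -> measurable_fun D v ->
  (forall x, D x -> 0 <= u x) -> (forall x, D x -> u x <= v x) ->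
  \int[mu]_(x in D) u x < +oo ->
  \int[mu]_(x in D) v x <= \int[mu]_(x in D) u x ->
  mu.-negligible [set x | D x /\ u x <> v x].
Proof.
move=> mD mU mV u0 uv uoo vu.
pose D1 := D `&` [set x | u x = +oo]; pose D2 := D `&` [set x | u x < +oo].
have mD1 : measurable D1.
  by rewrite /D1; apply: measurable_eqe => //.
have mD2 : measurable D2 by exact: emeasurable_fun_infty_o.
have DE : D = D1 `|` D2.
  apply/seteqP; split => [x Dx|x [[]|[]]]//.
  by have := leey (u x); rewrite le_eqVlt => /orP[/eqP|]; [left|right].
have dis : [disjoint D1 & D2].
  by apply/disj_setPS => x [[_ /= ux] [_ /=]]; rewrite ux ltxx.
have v0 x : D x -> 0 <= v x by move=> Dx; rewrite (le_trans (u0 x Dx))// uv.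
have split w : measurable_fun D w -> (forall x, D x -> 0 <= w x) ->
    \int[mu]_(x in D) w x =
    \int[mu]_(x in D1) w x + \int[mu]_(x in D2) w x.
  by move=> mw w0; rewrite {1}DE ge0_integral_setU// -DE.
have I1 : \int[mu]_(x in D1) v x = \int[mu]_(x in D1) u x.
  apply: eq_integral => x /set_mem[Dx ux]; apply/eqP.
  by rewrite eq_le uv// ux leey.
have fin1 : \int[mu]_(x in D1) u x \is a fin_num.
  rewrite ge0_fin_numE; last by apply: integral_ge0 => x [/u0].
  apply: le_lt_trans uoo; apply: ge0_subset_integral => //; exact: subIsetl.
have fin2 : \int[mu]_(x in D2) u x < +oo.
  apply: le_lt_trans uoo; apply: ge0_subset_integral => //; exact: subIsetl.
move: vu; rewrite !split// I1 leeD2lE// => vu.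
apply: negligibleS (eq_integral_null_fin mD2 _ _ _ _ fin2 vu).
- move=> x /= [Dx uvx]; split => //; split => //=.
  rewrite ltey; apply/eqP => ux; apply: uvx; apply/eqP.
  by rewrite eq_le uv// ux leey.
- by apply: measurable_funS mU => // x [].
- by apply: measurable_funS mV => // x [].
- by move=> x [/u0 ux0 /= uxoo]; rewrite ux0.
- by move=> x [/uv].
Qed.

End IntegralComparison.

(** * Measures with a density *)

Section IntegralDensity.
Context (R : realType) (d : measure_display) (T : measurableType d).
Variables (mu nu : {measure set T -> \bar R}) (w : T -> R).
Hypotheses (w0 : forall x, (0 <= w x)%R) (mw : measurable_fun setT w).
Hypothesis nuE : forall A, measurable A -> nu A = \int[mu]_(x in A) (w x)%:E.

Import HBNNSimple.

Let mwE D : measurable_fun D (EFin \o w).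
Proof. by apply/measurable_EFinP; exact: measurable_funTS. Qed.

Let density_nnsfun (h : {nnsfun T >-> R}) :
  \int[nu]_x (h x)%:E = \int[mu]_x ((h x)%:E * (w x)%:E).
Proof.
under [LHS]eq_integral do rewrite fimfunE -fsumEFin//.
rewrite [LHS]ge0_integral_fsum//; last 2 first.
- by move=> r; exact/measurable_EFinP/measurableT_comp.
- by move=> n x _; rewrite EFinM nnfun_muleindic_ge0.
under [RHS]eq_integral.
  move=> x _; rewrite fimfunE -fsumEFin// ge0_mule_fsuml; last first.
    by move=> r; rewrite EFinM nnfun_muleindic_ge0.
  over.
rewrite [RHS]ge0_integral_fsum//; last 2 first.
- move=> r; apply: emeasurable_funM => //.
  by apply/measurable_EFinP; do 2 apply/measurableT_comp => //.
- move=> n x _; apply: mule_ge0; last by rewrite lee_fin.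
  by rewrite EFinM nnfun_muleindic_ge0.
apply: eq_fsbigr => r _; rewrite integralZl_indic_nnsfun// integral_indic// setIT.
rewrite nuE//; have [r0|r0] := ltP r 0%R.
  rewrite preimage_nnfun0// integral_set0 mule0.
  by rewrite integral0_eq// => x _; rewrite indic0 mulr0 mul0e.
rewrite integral_mkcond -ge0_integralZl//.
- apply: eq_integral => x _; rewrite EFinM -muleA patchE indicE; congr (_ * _).
  by case: ifPn; rewrite ?mul1e ?mul0e.
- exact/(measurable_restrictT _ _).1.
- by move=> x _; rewrite patchE; case: ifP; rewrite ?lee_fin.
Qed.

(** Change of variables for a density. Restriction to an event and scaling are
    instances, with an indicator and a constant as density. *)
Lemma integral_density u : measurable_fun setT u -> (forall x, 0 <= u x) ->
  \int[nu]_x u x = \int[mu]_x (u x * (w x)%:E).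
Proof.
move=> mU u0; pose h := nnsfun_approx measurableT mU.
transitivity (limn (fun n => \int[nu]_x (h n x)%:E)).
  rewrite -monotone_convergence//=.
  - apply: eq_integral => x _; apply/esym/cvg_lim => //=.
    exact: cvg_nnsfun_approx.
  - by move=> n; exact/measurable_EFinP/measurable_funTS.
  - by move=> n x _; rewrite lee_fin.
  - by move=> x _ a b ab; rewrite lee_fin//; exact/lefP/nd_nnsfun_approx.
under eq_fun do rewrite density_nnsfun.
rewrite -monotone_convergence//=.
- apply: eq_integral => x _; apply/cvg_lim => //=.
  by apply: cvgeZr => //; exact: cvg_nnsfun_approx.
- by move=> n; apply: emeasurable_funM => //; exact/measurable_EFinP/measurable_funTS.
- by move=> n x _; rewrite mule_ge0// lee_fin.
- move=> x _ a b ab; rewrite lee_wpmul2r// lee_fin//.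
  exact/lefP/nd_nnsfun_approx.
Qed.

End IntegralDensity.

Definition weighted (R : realType) (d : measure_display) (T : measurableType d)
    (mu : {measure set T -> \bar R}) (u : T -> \bar R)
    (u0 : forall x, 0 <= u x) (mu' : measurable_fun setT u) (A : set T) : \bar R :=
  \int[mu]_(x in A) u x.

Section Weighted.
Context (R : realType) (d : measure_display) (T : measurableType d).
Variables (mu : {measure set T -> \bar R}) (u : T -> \bar R).
Hypotheses (u0 : forall x, 0 <= u x) (mU : measurable_fun setT u).

Let weighted0 : weighted mu u0 mU set0 = 0.
Proof. exact: integral_set0. Qed.

Let weighted_ge0 A : 0 <= weighted mu u0 mU A.
Proof. exact: integral_ge0. Qed.

Let weighted_sigma_additive : semi_sigma_additive (weighted mu u0 mU).
Proof.
move=> F mF tF mUF; rewrite /weighted ge0_integral_bigcup//.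
  apply: is_cvg_ereal_nneg_natsum_cond => n _ _; exact: integral_ge0.
exact: measurable_funTS.
Qed.

HB.instance Definition _ := isMeasure.Build _ _ _ (weighted mu u0 mU)
  weighted0 weighted_ge0 weighted_sigma_additive.

End Weighted.

(** * The log-likelihood ratio *)

Lemma measurable_inv_ge0 (R : realType) (d : measure_display)
    (E : measurableType d) (u : E -> R) : (forall x, (0 <= u x)%R) ->
  measurable_fun setT u -> measurable_fun setT (fun x => (u x)^-1)%R.
Proof.
move=> u0 mu.
have -> : (fun x => (u x)^-1)%R =
    (fun x => if u x == 0 then 0 else expR (- ln (u x)))%R.
  apply/funext => x; case: eqVneq => [->|ux]; first by rewrite invr0.
  by rewrite expRN lnK// posrE lt_neqAle eq_sym ux u0.
apply: measurable_fun_ifT => //; first exact: measurable_fun_eqr.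
apply: measurableT_comp; first exact: measurable_expR.
by apply: measurableT_comp => //; apply: measurableT_comp => //; exact: measurable_ln.
Qed.

Section LogLikelihoodRatio.
Context (R : realType) (d : measure_display) (E : measurableType d).
Variables (f g : E -> R).
Hypotheses (f0 : forall x, (0 <= f x)%R) (g0 : forall x, (0 <= g x)%R).

Lemma llr_gt0 x : (0 < llr f g x) = (f x < g x)%R.
Proof.
rewrite /llr lne_gt0; have [fx|fx] := eqVneq (f x) 0%R.
  rewrite fx inve0; have [gx|gx] := eqVneq (g x) 0%R.
    by rewrite gx mul0e ltxx lte_fin ltr10.
  have gx0 : (0 < g x)%R by rewrite lt_neqAle eq_sym gx g0.
  by rewrite gt0_muley ?lte_fin// ltry gx0.
have fx0 : (0 < f x)%R by rewrite lt_neqAle eq_sym fx f0.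
by rewrite inver (negbTE fx) -EFinM lte_fin ltr_pdivlMr// mul1r.
Qed.

Lemma llr_le0 x : (llr f g x <= 0) = (g x <= f x)%R.
Proof. by rewrite leNgt llr_gt0 -leNgt. Qed.

Lemma measurable_llr : measurable_fun setT f -> measurable_fun setT g ->
  measurable_fun setT (llr f g).
Proof.
move=> mf mg.
have -> : llr f g = fun x => if f x == 0%R then (if g x == 0%R then -oo else +oo)
    else if g x == 0%R then -oo else (ln (g x / f x))%:E.
  apply/funext => x; rewrite /llr; case: eqVneq => [->|fx].
    rewrite inve0; case: eqVneq => [->|gx]; first by rewrite mul0e le0_lneNy.
    by rewrite gt0_muley// lte_fin lt_neqAle eq_sym gx g0.
  rewrite inver (negbTE fx) -EFinM; case: eqVneq => [->|gx].
    by rewrite mul0r le0_lneNy.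
  by rewrite lne_EFin// divr_gt0// lt_neqAle eq_sym ?fx ?gx ?f0 ?g0.
have meq0 (u : E -> R) : measurable_fun setT u ->
    measurable_fun setT (fun x => u x == 0%R).
  by move=> mu; apply: measurable_fun_eqr.
apply: measurable_fun_ifT; [exact: meq0| |].
  by apply: measurable_fun_ifT => //; exact: meq0.
apply: measurable_fun_ifT => //; first exact: meq0.
apply/measurable_EFinP; apply: measurableT_comp; first exact: measurable_ln.
apply: measurable_funM => //.
exact: measurable_inv_ge0.
Qed.

End LogLikelihoodRatio.

(** Positivity of the information tells the two densities apart on the set
    [f < g]; finiteness makes the law with density [g] absolutely continuous with
    respect to the law with density [f]. *)
Section Information.
Context (R : realType) (d : measure_display) (E : measurableType d).
Variables (lam : {sigma_finite_measure set E -> \bar R}) (f g : E -> R).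
Hypotheses (df : is_density lam f) (dg : is_density lam g).
Hypothesis KL : (0 < KL_information lam f g < +oo)%E.

Let f0 x : (0 <= f x)%R. Proof. by have [_ f0 _] := df; exact: f0. Qed.
Let g0 x : (0 <= g x)%R. Proof. by have [_ g0 _] := dg; exact: g0. Qed.
Let mf : measurable_fun setT f. Proof. by have [] := df. Qed.
Let mg : measurable_fun setT g. Proof. by have [] := dg. Qed.
Let mf' D : measurable_fun D (EFin \o f).
Proof. by apply/measurable_EFinP; exact: measurable_funTS. Qed.
Let mg' D : measurable_fun D (EFin \o g).
Proof. by apply/measurable_EFinP; exact: measurable_funTS. Qed.

Let B := [set x | f x = 0%R /\ g x <> 0%R].
Let mB : measurable B.
Proof.
have -> : B = (f @^-1` [set 0%R]) `&` ~` (g @^-1` [set 0%R]) by [].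
apply: measurableI.
  by rewrite -[X in measurable X]setTI; apply: mf.
by apply: measurableC; rewrite -[X in measurable X]setTI; apply: mg.
Qed.

Let h x := llr f g x * (g x)%:E.
Let mh : measurable_fun setT h.
Proof. by apply: emeasurable_funM => //; exact: measurable_llr. Qed.

(** The log-likelihood ratio is infinite on [B], which has positive probability
    under [g] unless it is null. *)
Let lamB : lam B = 0.
Proof.
have hp : \int[lam]_x (h^\+ x) < +oo.
  rewrite ltNge leye_eq; apply/negP => /eqP hpE.
  move: KL; rewrite /KL_information integralE -/h hpE.
  by case: (\int[lam]_x (h^\- x)) => [r| |] //=; rewrite ltxx andbF.
have ip : lam.-integrable setT h^\+.
  apply/integrableP; split; first exact: measurable_funepos.
  by under eq_integral do rewrite gee0_abs//.
have := integrable_ae measurableT ip.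
move=> [C [mC C0 BC]]; apply/eqP; rewrite eq_le measure_ge0 andbT -C0.
apply: le_measure; rewrite ?inE// => x [fx gx]; apply: BC => /= /(_ I).
suff -> : h^\+ x = +oo by [].
have gx0 : (0 < g x)%R by rewrite lt_neqAle eq_sym g0 andbT; apply/eqP.
by rewrite funeposE /h /llr fx inve0 gt0_muley// /= gt0_mulye.
Qed.

Definition likelihood_ratio x := (g x / f x)%R.

Lemma likelihood_ratio_ge0 x : (0 <= likelihood_ratio x)%R.
Proof. exact: divr_ge0. Qed.

Lemma measurable_likelihood_ratio : measurable_fun setT likelihood_ratio.
Proof. by apply: measurable_funM => //; exact: measurable_inv_ge0. Qed.

(** The two sides only differ on [B], where the ratio is [0] by convention. *)
Lemma integral_likelihood_ratio A : measurable A ->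
  \int[lam]_(x in A) ((likelihood_ratio x)%:E * (f x)%:E) =
  \int[lam]_(x in A) (g x)%:E.
Proof.
move=> mA; apply: ge0_ae_eq_integral => //.
- apply: emeasurable_funM => //.
  by apply/measurable_EFinP; apply/measurable_funTS/measurable_likelihood_ratio.
- by move=> x _; rewrite mule_ge0// lee_fin// likelihood_ratio_ge0.
- by move=> x _; rewrite lee_fin.
exists B; split => // x /=; apply: contra_notP => xB Ax.
rewrite -EFinM /likelihood_ratio; have [fx|fx] := eqVneq (f x) 0%R.
  rewrite fx mulr0; congr EFin; apply/esym/eqP/negPn/negP => /eqP gx.
  exact: xB.
by rewrite divfK.
Qed.

Let A := [set x | (f x < g x)%R].
Let mA : measurable A.
Proof.
have -> : A = (fun x => (f x < g x)%R) @^-1` [set true].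
  by apply/seteqP; split => x /=.
by rewrite -[X in measurable X]setTI; apply: measurable_fun_ltr.
Qed.

Let int_le1 (u : E -> R) D : is_density lam u -> measurable D ->
  \int[lam]_(x in D) (u x)%:E <= 1.
Proof.
move=> [mu u0 <-] mD; apply: ge0_subset_integral => //.
  exact/measurable_EFinP.
by move=> x _; rewrite lee_fin.
Qed.

Let density_eq_null (u v : E -> R) D : is_density lam u -> is_density lam v ->
  measurable D -> (forall x, D x -> (u x <= v x)%R) ->
  \int[lam]_(x in D) (v x)%:E <= \int[lam]_(x in D) (u x)%:E ->
  lam.-negligible [set x | D x /\ u x <> v x].
Proof.
move=> du dv mD uv vu; have [mu u0 _] := du; have [mv _ _] := dv.
have : lam.-negligible [set x | D x /\ (u x)%:E <> (v x)%:E].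
  apply: eq_integral_null => //.
  - by apply/measurable_EFinP; exact: measurable_funTS.
  - by apply/measurable_EFinP; exact: measurable_funTS.
  - by move=> x _; rewrite lee_fin.
  - exact: le_lt_trans (int_le1 du mD) (ltry 1%R).
by apply: negligibleS => x [Dx uvx]; split => // -[].
Qed.

(** Otherwise [f] and [g] would agree almost everywhere. *)
Lemma density_gap : \int[lam]_(x in A) (f x)%:E < \int[lam]_(x in A) (g x)%:E.
Proof.
rewrite ltNge; apply/negP => gf.
have negA : lam.-negligible A.
  apply: negligibleS (density_eq_null df dg mA _ gf); last by move=> x; exact: ltW.
  by move=> x /= Ax; split => //; apply/eqP; rewrite lt_eqF.
have A0 : lam A = 0 by apply: (negligibleP _ mA).1.
have null u : is_density lam u -> \int[lam]_(x in ~` A) (u x)%:E = 1.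
  move=> du; have [mu u0 <-] := du.
  rewrite -(setUv A) ge0_integral_setU//.
  - rewrite (null_set_integral _ _ A0)// ?add0e//.
    by apply/measurable_EFinP; exact: measurable_funTS.
  - exact: measurableC.
  - apply/measurable_EFinP; exact: measurable_funTS.
  - by move=> x _; rewrite lee_fin.
  - by apply/disj_setPCl.
have negCA : lam.-negligible [set x | (~` A) x /\ g x <> f x].
  apply: density_eq_null => //; first exact: measurableC.
    by move=> x /negP; rewrite -leNgt.
  by rewrite !null.
move: KL => /andP[]; rewrite (_ : KL_information _ _ _ = 0) ?ltxx//.
rewrite /KL_information -(integral0 lam setT).
apply: ae_eq_integral => //.
apply: negligibleS (negligibleU negA negCA) => x /=.
move=> nz; have [Ax|nAx] := pselect (A x); [by left|right; split=> // gfx].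
apply: nz => _; rewrite /llr gfx; have [->|fx] := eqVneq (f x) 0%R.
  by rewrite mule0.
by rewrite inver (negbTE fx) -EFinM divff// lne1 mul0e.
Qed.

(** Otherwise [f] would vanish almost everywhere on [f < g], and [g] too by
    absolute continuity, against [density_gap]. *)
Lemma llr_pos_prob : 0 < \int[lam]_(x in [set x | 0 < llr f g x]) (f x)%:E.
Proof.
have -> : [set x | 0 < llr f g x] = A.
  by apply/seteqP; split => x /=; rewrite llr_gt0.
rewrite lt_neqAle integral_ge0 ?andbT; last by move=> x _; rewrite lee_fin.
apply/eqP => /esym fA; have := density_gap; rewrite fA; apply/negP.
rewrite -leNgt -integral_likelihood_ratio//.
rewrite (ae_eq_integral (cst 0)) ?integral0//.
  apply: emeasurable_funM => //.
  by apply/measurable_EFinP; apply/measurable_funTS/measurable_likelihood_ratio.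
have fA' : \int[lam]_(x in A) `|(EFin \o f) x| = 0.
  by rewrite -fA; apply: eq_integral => x _; rewrite gee0_abs// lee_fin.
have [C [mC C0 AC]] := (ae_eq_integral_abs lam mA (@mf' A)).1 fA'.
exists C; split => // x /= nz; apply: AC => /= fx; apply: nz => Ax.
by have := fx Ax => ->; rewrite mule0.
Qed.

(** Otherwise [f] would have total mass [1] on [f < g], where [g] has more. *)
Lemma llr_nonpos_prob : 0 < \int[lam]_(x in [set x | llr f g x <= 0]) (f x)%:E.
Proof.
have -> : [set x | llr f g x <= 0] = ~` A.
  by apply/seteqP; split => x /=; rewrite llr_le0// leNgt => /negP.
rewrite lt_neqAle integral_ge0 ?andbT; last by move=> x _; rewrite lee_fin.
apply/eqP => /esym fA; have := lt_le_trans density_gap (int_le1 dg mA).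
have [_ _ f1] := df; rewrite -[ltRHS]f1 -(setUv A) ge0_integral_setU//.
- by rewrite fA adde0 ltxx.
- exact: measurableC.
- by move=> x _; rewrite lee_fin.
- by apply/disj_setPCl.
Qed.

End Information.

(** * Conditional expectation *)

Section ConditionalExpectation.
Context (R : realType) (d : measure_display) (W : measurableType d).
Variables (P : probability W R) (F : set (set W)).
Hypothesis mF : F `<=` measurable.
Implicit Types (Y Z : W -> \bar R) (A : set W).

Let GT := g_sigma_algebraType F.

Lemma measurable_sigma A : <<s F >> A -> measurable A.
Proof. by apply: smallest_sub => //; exact: sigma_algebra_measurable. Qed.

Let mid : measurable_fun [set: W] (id : W -> GT).
Proof. by move=> _ A mA; rewrite setTI preimage_id; exact: measurable_sigma. Qed.

Lemma measurable_fun_sigma Z D : measurable_fun setT (Z : GT -> \bar R) ->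
  measurable_fun D Z.
Proof.
by move=> mZ; apply: measurable_funTS; exact: (measurableT_comp mZ mid).
Qed.

Let proj : {mfun W >-> GT} := mfun_Sub (mem_set mid).

Let Q : probability GT R := distribution P proj.

Let integral_proj Z A : measurable_fun setT (Z : GT -> \bar R) ->
  (forall w, 0 <= Z w) -> F A -> \int[Q]_(w in A) Z w = \int[P]_(w in A) Z w.
Proof.
move=> mZ Z0 FA; rewrite /Q /distribution ge0_integral_pushforward//.
- exact: sub_sigma_algebra.
- exact: measurable_funTS.
Qed.

(** The measure with density [Y], restricted to [F], is finite and dominated by
    the restriction of [P]: its Radon-Nikodym derivative is the version. *)
Let cond_exp_bounded Y : measurable_fun setT Y -> (forall w, 0 <= Y w <= 1) ->
  exists Z, is_cond_exp P F Y Z.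
Proof.
move=> mY Y01.
have Y0 w : 0 <= Y w by have /andP[] := Y01 w.
have [nu0 nuE] : exists nu0 : {measure set GT -> \bar R},
    forall A, nu0 A = \int[P]_(w in A) Y w.
  by unshelve eexists (pushforward (weighted P Y0 mY) proj); first exact: mid.
have nu_fin : nu0 setT < +oo.
  rewrite nuE; apply: (@le_lt_trans _ _ (\int[P]_w cst 1 w)).
    by apply: le_integral_nonneg => // w; have /andP[] := Y01 w.
  rewrite integral_cst// mul1e.
  by apply: (le_lt_trans (probability_le1 P measurableT)); rewrite ltry.
pose nu : {finite_measure set GT -> \bar R} := mfrestr measurableT nu_fin.
have {}nuE A : nu A = \int[P]_(w in A) Y w.
  by rewrite -nuE; exact: (congr1 nu0 (setIT A)).
have nuQ : nu `<< Q.
  apply/null_content_dominatesP => A mA QA.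
  rewrite nuE null_set_integral//; first exact: measurable_sigma.
  exact: measurable_funTS.
have [Z [Z0 _ /integrableP[mZ _] ZE]] := radon_nikodym_sigma_finite nuQ.
exists Z; split => // A FA.
rewrite -integral_proj// -ZE// ?nuE//; exact: sub_sigma_algebra.
Qed.

(** Slices of height [1], to which the bounded case applies; they sum to [y] even
    when it is infinite. *)
Let slice (n : nat) (y : \bar R) : \bar R :=
  mine y (n.+1%:R : R)%:E - mine y (n%:R : R)%:E.

Let mine_fin (y : \bar R) n : 0 <= y -> mine y (n%:R : R)%:E \is a fin_num.
Proof.
move=> y0; rewrite ge0_fin_numE ?gt_min ?ltry ?orbT//.
by rewrite le_min y0 lee_fin/=.
Qed.

Let slice01 n y : 0 <= y -> 0 <= slice n y <= 1.
Proof.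
move=> y0; rewrite /slice sube_ge0 ?mine_fin//.
rewrite le_min2 ?lexx ?lee_fin ?ler_nat//=.
rewrite leeBlDr ?mine_fin//.
case: y y0 => [r|_|//]; last first.
  by rewrite !minye -EFinD -natr1 addrC.
move=> r0; rewrite -!EFin_min -EFinD lee_fin -natr1.
rewrite ge_min; case: (leP r n%:R) => _; first by rewrite lerDr ler01.
by rewrite addrC lexx orbT.
Qed.

Let sum_slice y : 0 <= y -> \sum_(n <oo) slice n y = y.
Proof.
move=> y0; apply/cvg_lim => //.
have sumE n : \sum_(0 <= i < n) slice i y = mine y (n%:R : R)%:E.
  elim: n => [|n IH]; first by rewrite big_nil; apply/esym/min_idPr.
  by rewrite big_nat_recr//= IH /slice [LHS]addeC subeK// mine_fin.
under eq_fun do rewrite sumE.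
case: y y0 sumE => [r r0 _|_ _|//].
  apply: cvg_near_cst; exists (Num.bound r) => // n /= rn.
  apply/min_idPl; rewrite lee_fin (le_trans (ltW (archi_boundP r0)))//.
  by rewrite ler_nat.
under eq_fun do rewrite minye.
by apply/cvgenyP; exact: cvg_id.
Qed.

Lemma cond_exp_exists Y : measurable_fun setT Y -> (forall w, 0 <= Y w) ->
  exists Z, is_cond_exp P F Y Z.
Proof.
move=> mY Y0.
have mS n : measurable_fun setT (fun w => slice n (Y w)).
  by apply: emeasurable_funB; apply: measurable_mine.
have /choice[Z ZP] n : exists Z, is_cond_exp P F (fun w => slice n (Y w)) Z.
  by apply: cond_exp_bounded => // w; exact: slice01.
have Z0 n w : 0 <= Z n w by have [] := ZP n.
have mZ n : measurable_fun setT (Z n : GT -> \bar R) by have [] := ZP n.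
exists (fun w => \sum_(n <oo) Z n w); split.
- by move=> w; apply: nneseries_ge0.
- by apply: ge0_emeasurable_sum => // k x _ _; exact: Z0.
move=> A FA; have mA : measurable A by exact: mF.
rewrite integral_nneseries//; last by move=> n; exact: measurable_fun_sigma.
under [RHS]eq_integral => w _ do rewrite -(sum_slice (Y0 w)).
rewrite [RHS]integral_nneseries//; last 2 first.
- by move=> n; exact: measurable_funTS.
- by move=> n w _; have /andP[] := slice01 n (Y0 w).
by apply: eq_eseriesr => n _; have [_ _ ->] := ZP n.
Qed.

(** On the event that [Z'] is below [Z] and bounded by [n], which is in [F], the
    two versions have the same finite integral. *)
Lemma le_cond_exp Y Y' Z Z' : F = <<s F >> ->
  is_cond_exp P F Y Z -> is_cond_exp P F Y' Z' ->
  (forall A, F A -> \int[P]_(w in A) Y w <= \int[P]_(w in A) Y' w) ->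
  P.-negligible [set w | Z' w < Z w].
Proof.
move=> FE [Z0 mZ ZE] [Z0' mZ' ZE'] YY'.
pose B n := [set w | Z' w < Z w] `&` [set w | Z' w <= n%:R%:E].
have FB n : F (B n).
  rewrite FE.
  have m1 : measurable ([set w : GT | Z' w < Z w]).
    by rewrite -[X in measurable X]setTI; exact: measurable_lte.
  have m2 : measurable ([set w : GT | Z' w <= n%:R%:E]).
    by rewrite -[X in measurable X]setTI; exact: emeasurable_fun_infty_c.
  exact: measurableI m1 m2.
have : P.-negligible (\bigcup_n B n).
  apply: negligible_bigcup => n.
  have mB : measurable (B n) by exact: mF.
  have : P.-negligible [set w | B n w /\ Z' w <> Z w].
    apply: eq_integral_null => //.
    - exact: measurable_fun_sigma.
    - exact: measurable_fun_sigma.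
    - by move=> w [/ltW].
    - apply: (@le_lt_trans _ _ (\int[P]_(w in B n) cst n%:R%:E w)).
        apply: ge0_le_integral => //; first exact: measurable_fun_sigma.
        by move=> w [].
      rewrite integral_cst//; apply: (@le_lt_trans _ _ (n%:R%:E * 1)).
        by rewrite lee_pmul// ?lee_fin// probability_le1.
      by rewrite mule1 ltry.
    - by rewrite ZE ?ZE'// YY'.
  apply: negligibleS => w Bw; split => //; case: Bw => + _ ZZ.
  by rewrite /= ZZ ltxx.
apply: negligibleS => w /= ZZ.
have [n Zn] : exists n, Z' w <= n%:R%:E.
  have : Z' w < +oo by rewrite (lt_le_trans ZZ)// leey.
  case: (Z' w) (Z0' w) => [r r0 _| |]//.
  by exists (Num.bound r); rewrite lee_fin (ltW (archi_boundP _)).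
by exists n.
Qed.

End ConditionalExpectation.

(** * Measurability of the honest alarms *)

Section MeasurableRules.
Context (R : realType) (d d' : measure_display).
Context (E : measurableType d) (W : measurableType d').

(** A first time is below [r] when the condition holds at one of the times before
    [r], whether or not the infimum is attained. *)
Lemma measurable_first_time (p : nat -> set W) :
  (forall t, (0 < t)%N -> measurable (p t)) ->
  measurable_fun setT (fun w => first_time R (fun t => p t w)).
Proof.
move=> mp; apply: (measurability _ (ErealGenInftyO.measurableE R)).
move=> _ [_ [r ->] <-]; rewrite setTI.
rewrite [X in measurable X](_ : _ =
    \bigcup_(t in [set t : nat | (0 < t)%N /\ (t%:R < r)%R]) p t).
  by apply: bigcup_measurable => t [t0 _]; exact: mp.
apply/seteqP; split => w /=; rewrite in_itv /=.
  by move=> /ereal_inf_ltP[_ [t [t0 pt] <-]]; rewrite lte_fin; exists t.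
move=> [t [t0 tr] pt]; apply: le_lt_trans (first_time_le R t0 pt) _.
by rewrite lte_fin.
Qed.

Variables (f g : E -> R).
Hypotheses (f0 : forall x, (0 <= f x)%R) (g0 : forall x, (0 <= g x)%R).
Hypotheses (mf : measurable_fun setT f) (mg : measurable_fun setT g).

Lemma measurable_cusum (U : nat -> W -> E) t :
  (forall s, (0 < s <= t)%N -> measurable_fun setT (U s)) ->
  measurable_fun setT (fun w => cusum f g (U^~ w) t).
Proof.
elim: t => [|t IH] mU //=.
apply: measurable_maxe => //; apply: emeasurable_funD.
  by apply: IH => s /andP[s0 st]; apply: mU; rewrite s0 ltnW.
by apply: measurableT_comp; [exact: measurable_llr|apply: mU; rewrite /= ltnSn].
Qed.

Variables (K : nat) (N : {set 'I_K}) (X : 'I_K -> nat -> W -> E).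
Hypothesis mX : forall k t, k \in N -> (0 < t)%N -> measurable_fun setT (X k t).

Lemma measurable_honest_cusum k t : k \in N ->
  measurable_fun setT (fun w => cusum f g (fun s => X k s w) t).
Proof. by move=> kN; apply: measurable_cusum => s /andP[s0 _]; exact: mX. Qed.

Lemma measurable_first_honest_alarm h :
  measurable_fun setT (fun w => first_honest_alarm f g N h (fun k s => X k s w)).
Proof.
apply: (@measurable_first_time (fun t => [set w | exists2 j, j \in N &
  h%:E <= cusum f g (fun s => X j s w) t])) => t _.
have -> : [set w | exists2 j, j \in N & h%:E <= cusum f g (fun s => X j s w) t] =
    \bigcup_(j in [set` N]) [set w | h%:E <= cusum f g (fun s => X j s w) t].
  by apply/seteqP; split => w [j jN hj]; exists j.
apply: fin_bigcup_measurable => [|j jN]; first exact: finite_finset.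
rewrite -[X in measurable X]setTI; apply: emeasurable_fun_c_infty => //.
exact: measurable_honest_cusum.
Qed.

Lemma measurable_joint_honest_alarm h :
  measurable_fun setT (fun w => joint_honest_alarm f g N h (fun k s => X k s w)).
Proof.
apply: (@measurable_first_time (fun t => [set w | forall j, j \in N ->
  h%:E <= cusum f g (fun s => X j s w) t])) => t _.
have -> : [set w | forall j, j \in N -> h%:E <= cusum f g (fun s => X j s w) t] =
    \bigcap_(j in [set` N]) [set w | h%:E <= cusum f g (fun s => X j s w) t].
  by apply/seteqP; split => w hw j /hw.
apply: fin_bigcap_measurable => [|j jN]; first exact: finite_finset.
rewrite -[X in measurable X]setTI; apply: emeasurable_fun_c_infty => //.
exact: measurable_honest_cusum.
Qed.

End MeasurableRules.

(** * Independent observations and change of law *)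

Section Laws.
Context (R : realType) (d d' : measure_display).
Context (E : measurableType d) (W : measurableType d').
Variables (lam : {sigma_finite_measure set E -> \bar R}) (f g : E -> R).
Variables (K : nat) (N : {set 'I_K}) (X : 'I_K -> nat -> W -> E).
Hypotheses (df : is_density lam f) (dg : is_density lam g).
Hypothesis KL : (0 < KL_information lam f g < +oo)%E.
Hypothesis mX : forall k t, k \in N -> (0 < t)%N -> measurable_fun setT (X k t).

Implicit Types (i : 'I_K * nat) (s r : seq ('I_K * nat)).
Implicit Types (A : 'I_K * nat -> set E) (c : 'I_K -> nat -> bool).

Let f0 x : (0 <= f x)%R. Proof. by have [_ f0 _] := df; exact: f0. Qed.
Let g0 x : (0 <= g x)%R. Proof. by have [_ g0 _] := dg; exact: g0. Qed.
Let mf : measurable_fun setT f. Proof. by have [] := df. Qed.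
Let mg : measurable_fun setT g. Proof. by have [] := dg. Qed.

Definition honest_coord i := (i.1 \in N) && (0 < i.2)%N.

(** The cylinders over [s] generate the sigma-algebra of the observations with
    indices in [s]; a law is determined on them by independence. *)
Definition cylinder s A : set W :=
  \bigcap_(i in [set` s]) (X i.1 i.2 @^-1` A i).

Definition density_at c i := if c i.1 i.2 then g else f.

Lemma measurable_coord i C : honest_coord i -> measurable C ->
  measurable (X i.1 i.2 @^-1` C).
Proof.
move=> /andP[iN i0] mC; rewrite -[X in measurable X]setTI.
exact: mX.
Qed.

Lemma measurable_cylinder s A : all honest_coord s ->
  (forall i, i \in s -> measurable (A i)) -> measurable (cylinder s A).
Proof.
move=> /allP sD mA; apply: fin_bigcap_measurable => // i si.
by apply: measurable_coord; [exact: sD|exact: mA].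
Qed.

Lemma cylinder_cons i s A : cylinder (i :: s) A =
  (X i.1 i.2 @^-1` A i) `&` cylinder s A.
Proof. by rewrite /cylinder !bigcap_seq big_cons. Qed.

Lemma eq_cylinder s A A' : {in s, forall i, A i = A' i} ->
  cylinder s A = cylinder s A'.
Proof. by move=> AA; apply: eq_bigcapr => i /= /AA ->. Qed.

Lemma perm_cylinder s r A : perm_eq s r -> cylinder s A = cylinder r A.
Proof. by move=> sr; rewrite /cylinder !bigcap_seq; exact: perm_big. Qed.

Section OneLaw.
Variables (c : 'I_K -> nat -> bool) (Q : probability W R).
Hypothesis lawQ : honest_law lam f g N X c Q.

Lemma prob_coord i C : honest_coord i -> measurable C ->
  Q (X i.1 i.2 @^-1` C) = \int[lam]_(x in C) (density_at c i x)%:E.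
Proof. by move=> /andP[iN i0] mC; rewrite lawQ.2. Qed.

Lemma prob_cylinder s A : uniq s -> all honest_coord s ->
  (forall i, i \in s -> measurable (A i)) ->
  Q (cylinder s A) = \prod_(i <- s) \int[lam]_(x in A i) (density_at c i x)%:E.
Proof.
move=> us /allP sD mA; rewrite lawQ.1//; last first.
  by move=> i si; split; [exact: sD|exact: mA].
by apply: eq_big_seq => i si; apply: prob_coord; [exact: sD|exact: mA].
Qed.

Lemma prob_cylinder_cons i s A : uniq (i :: s) -> all honest_coord (i :: s) ->
  (forall j, j \in i :: s -> measurable (A j)) ->
  Q (cylinder (i :: s) A) =
  \int[lam]_(x in A i) (density_at c i x)%:E * Q (cylinder s A).
Proof.
move=> us sD mA; rewrite prob_cylinder// big_cons prob_cylinder//.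
- by case/andP: us.
- by case/andP: sD.
- by move=> j js; apply: mA; rewrite inE js orbT.
Qed.

(** Both sides are the integral of [u] for the image under the observation [i] of
    [Q] restricted to the cylinder, of which independence gives the density. *)
Lemma integral_coord i s A (u : E -> \bar R) :
  uniq (i :: s) -> all honest_coord (i :: s) ->
  (forall j, j \in s -> measurable (A j)) ->
  measurable_fun setT u -> (forall x, 0 <= u x) ->
  \int[Q]_(w in cylinder s A) u (X i.1 i.2 w) =
  Q (cylinder s A) * \int[lam]_x (u x * (density_at c i x)%:E).
Proof.
move=> us sD mA mU u0.
have [iD sD'] : honest_coord i /\ all honest_coord s by apply/andP.
have is_notin : i \notin s by case/andP: us.
have mG : measurable (cylinder s A) by exact: measurable_cylinder.
have mXi : measurable_fun setT (X i.1 i.2).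
  by apply: mX; case/andP: iD.
set q := fine (Q (cylinder s A)).
have qE : Q (cylinder s A) = q%:E by rewrite fineK// fin_num_measure.
have q0 : (0 <= q)%R by rewrite fine_ge0.
pose QG : {measure set W -> \bar R} := mrestr Q mG.
have [nu nuE] : exists nu : {measure set E -> \bar R},
    nu = pushforward QG (X i.1 i.2) :> (set E -> \bar R).
  by unshelve eexists (pushforward QG (X i.1 i.2)); first exact: mXi.
have dens0 x : (0 <= density_at c i x)%R by rewrite /density_at; case: ifP.
have mdens : measurable_fun setT (density_at c i).
  by rewrite /density_at; case: ifP.
have nu_dens C : measurable C ->
    nu C = \int[lam]_(x in C) (q * density_at c i x)%:E.
  move=> mC; have -> : nu C = Q (X i.1 i.2 @^-1` C `&` cylinder s A) by rewrite nuE.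
  pose A' := fun j => if j == i then C else A j.
  have -> : cylinder s A = cylinder s A'.
    apply: eq_cylinder => j js; rewrite /A' ifN//.
    by apply: contraNneq is_notin => <-.
  have {1}-> : C = A' i by rewrite /A' eqxx.
  rewrite -cylinder_cons prob_cylinder_cons//; last first.
    move=> j; rewrite /A' inE; case: eqP => //= _; exact: mA.
  rewrite /A' eqxx muleC -(@eq_cylinder s A); last first.
    by move=> j js; rewrite ifN//; apply: contraNneq is_notin => <-.
  rewrite qE -ge0_integralZl//.
  - by apply/measurable_EFinP; exact: measurable_funTS.
  - by move=> x _; rewrite lee_fin.
transitivity (\int[nu]_x u x).
  rewrite nuE.
  have -> : \int[pushforward QG (X i.1 i.2)]_x u x =
      \int[QG]_w u (X i.1 i.2 w).
    by rewrite ge0_integral_pushforward.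
  rewrite (@integral_density _ _ _ Q QG (\1_(cylinder s A)))//.
  - rewrite [LHS]integral_mkcond; apply: eq_integral => w _.
    by rewrite epatch_indic.
  - by move=> B mB; rewrite /QG /= /mrestr integral_indic// setIC.
  - exact: measurableT_comp.
rewrite (integral_density _ _ nu_dens)//.
- rewrite qE -ge0_integralZl//.
  + by apply: eq_integral => x _; rewrite EFinM muleCA.
  + by apply: emeasurable_funM => //; exact/measurable_EFinP.
  + by move=> x _; rewrite mule_ge0// lee_fin.
- by move=> x; rewrite mulr_ge0.
- exact: measurable_funM.
Qed.

End OneLaw.

Let mXE (u : E -> \bar R) i : honest_coord i -> measurable_fun setT u ->
  measurable_fun setT (fun w => u (X i.1 i.2 w)).
Proof.
by move=> /andP[iN i0] mU; apply: measurableT_comp => //; exact: mX.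
Qed.

(** Reweighting [Q] by the likelihood ratio of the observation [i] changes the law
    of this observation from [f] to [g] and leaves the others as they are. *)
Lemma change_coord c Q i : honest_law lam f g N X c Q -> honest_coord i ->
  c i.1 i.2 = false ->
  exists Q' : probability W R,
    honest_law lam f g N X (fun k t => ((k, t) == i) || c k t) Q' /\
    forall B, measurable B -> Q B = 0 -> Q' B = 0.
Proof.
move=> lawQ iD ci.
pose v w := (likelihood_ratio f g (X i.1 i.2 w))%:E.
have lr0 := @likelihood_ratio_ge0 _ _ _ _ _ _ df dg.
have mlr := @measurable_likelihood_ratio _ _ _ _ _ _ df dg.
have v0 w : 0 <= v w by rewrite lee_fin.
have mv : measurable_fun setT v.
  by apply: (mXE (u := EFin \o likelihood_ratio f g)) => //; exact/measurable_EFinP.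
have vE s A : uniq (i :: s) -> all honest_coord (i :: s) ->
    (forall j, j \in i :: s -> measurable (A j)) ->
    weighted Q v0 mv (cylinder (i :: s) A) =
    \int[lam]_(x in A i) (g x)%:E * Q (cylinder s A).
  move=> us sD mA; have mAi := mA i (mem_head _ _).
  rewrite /weighted cylinder_cons integral_mkcondl.
  pose u x := (likelihood_ratio f g x)%:E * (\1_(A i) x)%:E.
  transitivity (\int[Q]_(w in cylinder s A) u (X i.1 i.2 w)).
    by apply: eq_integral => w _; rewrite epatch_indic.
  rewrite (integral_coord lawQ)//; first last.
  - by move=> x; rewrite mule_ge0 ?lee_fin.
  - by apply: emeasurable_funM; exact/measurable_EFinP.
  - by move=> j js; apply: mA; rewrite inE js orbT.
  rewrite muleC -(integral_likelihood_ratio df dg KL mAi); congr (_ * _).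
  rewrite [RHS]integral_mkcond; apply: eq_integral => x _.
  rewrite epatch_indic /= /u /density_at ci.
  by rewrite -!muleA; congr (_ * _); rewrite muleC.
have vT : weighted Q v0 mv setT = 1.
  have cyl0 : cylinder [::] (fun=> setT) = setT by rewrite /cylinder bigcap_seq big_nil.
  have := vE [::] (fun=> setT); rewrite cylinder_cons cyl0 preimage_setT setTI /=.
  move=> -> //; last by rewrite iD.
  by have [_ _ ->] := dg; rewrite mul1e probability_setT.
pose mu : {measure set W -> \bar R} := weighted Q v0 mv.
have muT : mu setT = 1 by exact: vT.
pose Q' : probability W R := mnormalize mu Q.
have Q'E B : Q' B = weighted Q v0 mv B.
  by rewrite /Q' /= /mnormalize muT onee_eq0 /= invr1 mule1.
have Q'one s A : uniq (i :: s) -> all honest_coord (i :: s) ->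
    (forall j, j \in s -> measurable (A j)) ->
    Q' (cylinder s A) = Q (cylinder s A).
  move=> us sD mA; have is_notin : i \notin s by case/andP: us.
  pose A' := fun j => if j == i then setT else A j.
  have AA' : cylinder s A = cylinder s A'.
    apply: eq_cylinder => j' js; rewrite /A' ifN//.
    by apply: contraNneq is_notin => <-.
  have -> : Q' (cylinder s A) = Q' (cylinder (i :: s) A').
    by rewrite cylinder_cons {1}/A' eqxx preimage_setT setTI AA'.
  rewrite Q'E vE//; last first.
    by move=> k; rewrite inE /A'; case: eqP => //= _; exact: mA.
  by rewrite {1}/A' eqxx; have [_ _ ->] := dg; rewrite mul1e AA'.
exists Q'; split; last first.
  by move=> B mB QB; rewrite Q'E /weighted null_set_integral//; exact: measurable_funTS.
split.
  move=> s A us sD.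
  have {}sD : all honest_coord s /\ forall j, j \in s -> measurable (A j).
    by split => [|j /sD[]//]; apply/allP => j /sD[].
  case: sD => sD mA; rewrite -/(cylinder s A).
  have Q'coord j : honest_coord j -> j != i -> measurable (A j) ->
      Q' (X j.1 j.2 @^-1` A j) = Q (X j.1 j.2 @^-1` A j).
    move=> jD ji mAj; have := @Q'one [:: j] A.
    rewrite cylinder_cons /cylinder bigcap_seq big_nil setIT; apply.
    - by rewrite /= inE eq_sym ji.
    - by rewrite /= iD jD.
    - by move=> k; rewrite inE => /eqP->.
  have Qprod r : uniq r -> all honest_coord r ->
      (forall j, j \in r -> measurable (A j)) -> i \notin r ->
      Q (cylinder r A) = \prod_(j <- r) Q' (X j.1 j.2 @^-1` A j).
    move=> ur /allP rD mA' ir; rewrite lawQ.1//; last first.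
      by move=> j jr; split; [exact: rD|exact: mA'].
    apply: eq_big_seq => j jr; rewrite Q'coord//; [exact: rD| |exact: mA'].
    by apply: contraNneq ir => <-.
  have [si|si] := boolP (i \in s); last first.
    by rewrite Q'one ?Qprod//=; [rewrite si|rewrite iD].
  have ps := perm_to_rem si.
  have us' : uniq (i :: rem i s) by rewrite -(perm_uniq ps).
  have sD' : all honest_coord (i :: rem i s) by rewrite -(perm_all _ ps).
  have mA' j : j \in i :: rem i s -> measurable (A j).
    by rewrite -(perm_mem ps); exact: mA.
  rewrite (perm_cylinder _ ps) (perm_big _ ps) big_cons Q'E vE//.
  have [us1 us2] : i \notin rem i s /\ uniq (rem i s) by apply/andP.
  have [_ sD2] : honest_coord i /\ all honest_coord (rem i s) by apply/andP.
  rewrite -Qprod//; last by move=> j jr; apply: mA'; rewrite inE jr orbT.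
  congr (_ * _); have := vE [::] A isT.
  rewrite cylinder_cons /cylinder bigcap_seq big_nil setIT -Q'E => ->.
  - by rewrite probability_setT mule1.
  - by rewrite /= iD.
  - by move=> j; rewrite inE => /eqP->; exact: mA.
move=> k t A kN t0 mA.
have ktD : honest_coord (k, t) by rewrite /honest_coord kN.
have [kti|kti] := eqVneq (k, t) i.
  have := vE [::] (fun=> A) isT; rewrite -kti.
  rewrite cylinder_cons /cylinder bigcap_seq big_nil setIT -Q'E => -> //.
  - by rewrite probability_setT mule1.
  - by rewrite /= ktD.
have := @Q'one [:: (k, t)] (fun=> A).
rewrite cylinder_cons /cylinder bigcap_seq big_nil setIT => -> //.
- by rewrite lawQ.2.
- by rewrite /= inE eq_sym kti.
- by rewrite /= iD ktD.
Qed.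

Lemma change_coords Q s : honest_law lam f g N X (@no_change K) Q ->
  all honest_coord s ->
  exists Q' : probability W R,
    honest_law lam f g N X (fun k t => (k, t) \in s) Q' /\
    forall B, measurable B -> Q B = 0 -> Q' B = 0.
Proof.
move=> lawQ; elim: s => [|i s IH] /=; first by exists Q.
move=> /andP[iD /IH[Q1 [law1 ac1]]].
have [si|si] := boolP (i \in s).
  exists Q1; split => //; rewrite [X in honest_law _ _ _ _ _ X](_ : _ =
    (fun k t => (k, t) \in s))//.
  apply/funext => k; apply/funext => t; rewrite inE.
  by case: eqP => [->|//]; rewrite si.
have [|Q2 [law2 ac2]] := change_coord law1 iD.
  by rewrite -surjective_pairing; exact/negbTE.
exists Q2; split => [//|B mB QB]; exact/ac2/ac1.
Qed.

Definition cylinders s : set (set W) :=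
  [set B | exists2 A, (forall i, i \in s -> measurable (A i)) & B = cylinder s A].

Lemma cylinders_measurable s : all honest_coord s ->
  cylinders s `<=` measurable.
Proof. by move=> sD _ [A mA ->]; exact: measurable_cylinder. Qed.

(** Events of the observations on [s] form a sigma-algebra generated by the
    cylinders over [s], a family closed under intersections, on which the two
    sides agree by independence. *)
Lemma transfer_law c1 c2 Q1 Q2 s r A B :
  honest_law lam f g N X c1 Q1 -> honest_law lam f g N X c2 Q2 ->
  {in s, forall i, c1 i.1 i.2 = c2 i.1 i.2} ->
  uniq (s ++ r) -> all honest_coord (s ++ r) ->
  (forall i, i \in r -> measurable (A i)) -> <<s cylinders s >> B ->
  Q1 (B `&` cylinder r A) = Q1 (cylinder r A) * Q2 B.
Proof.
move=> law1 law2 c12 usr srD mA sB.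
have [us [sr ur]] : uniq s /\ ~~ has (mem s) r /\ uniq r.
  by move: usr; rewrite cat_uniq => /and3P[].
have [sD rD] : all honest_coord s /\ all honest_coord r.
  by move: srD; rewrite all_cat => /andP[].
have mG : measurable (cylinder r A) by exact: measurable_cylinder.
pose m1 : {measure set W -> \bar R} := mrestr Q1 mG.
have q0 : (0 <= fine (Q1 (cylinder r A)))%R by rewrite fine_ge0.
pose q : {nonneg R} := NngNum q0.
pose m2 : {measure set W -> \bar R} := mscale q Q2.
have qE : Q1 (cylinder r A) = q%:num%:E by rewrite /= fineK// fin_num_measure.
have -> : Q1 (B `&` cylinder r A) = m1 B by [].
have -> : Q1 (cylinder r A) * Q2 B = m2 B by rewrite qE.
have cylT : cylinder s (fun=> setT) = setT.
  by rewrite -subTset => w _ i _.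
apply: (g_sigma_algebra_measure_unique (cylinders s)) (fun=> setT) _ _ _ _ _ _ _ _ sB.
- exact: cylinders_measurable.
- by move=> _; exists (fun=> setT); rewrite ?cylT.
- by rewrite bigcup_const//; exists 0%N.
- move=> _ _ [A1 mA1 ->] [A2 mA2 ->]; exists (fun i => A1 i `&` A2 i).
    by move=> i si; apply: measurableI; [exact: mA1|exact: mA2].
  by rewrite /cylinder -bigcapI.
- move=> _ [A1 mA1 ->].
  have -> : m1 (cylinder s A1) = Q1 (cylinder s A1 `&` cylinder r A) by [].
  have -> : m2 (cylinder s A1) = Q1 (cylinder r A) * Q2 (cylinder s A1).
    by rewrite qE.
  pose A' i := if i \in s then A1 i else A i.
  have A'r : cylinder r A = cylinder r A'.
    apply: eq_cylinder => i ir; rewrite /A' ifN//; apply: contra sr => si.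
    by apply/hasP; exists i.
  have A's : cylinder s A1 = cylinder s A'.
    by apply: eq_cylinder => i si; rewrite /A' si.
  have mA's i : i \in s -> measurable (A' i) by move=> si; rewrite /A' si; exact: mA1.
  have mA'r i : i \in r -> measurable (A' i).
    by move=> ir; rewrite /A'; case: ifP => [/mA1//|_]; exact: mA.
  rewrite A'r A's.
  have -> : cylinder s A' `&` cylinder r A' = cylinder (s ++ r) A'.
    by rewrite /cylinder !bigcap_seq big_cat.
  rewrite (prob_cylinder law1)//; last first.
    by move=> i; rewrite mem_cat => /orP[/mA's|/mA'r].
  rewrite (prob_cylinder law1)// (prob_cylinder law2)// big_cat muleC.
  congr (_ * _); apply: eq_big_seq => i si.
  by rewrite /density_at c12.
- move=> _; have -> : m1 setT = Q1 (setT `&` cylinder r A) by [].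
  rewrite (le_lt_trans (probability_le1 _ _)) ?ltry//.
  by rewrite setTI.
Qed.

End Laws.

(** * Waiting time for a run of successes *)

Section RunWaitingTime.
Context (R : realType) (d : measure_display) (W : measurableType d).
Variables (P : probability W R) (S : nat -> set W) (p : R) (b : nat).
Hypothesis mS : forall i, measurable (S i).
Hypothesis PS : forall r : seq nat, uniq r ->
  P (\bigcap_(i in [set` r]) S i) = (p ^+ size r)%:E.
Hypotheses (p0 : (0 < p)%R) (b0 : (0 < b)%N).

Fixpoint no_run n : set W :=
  if n is n'.+1 then no_run n' `\` \bigcap_(i in [set` iota (n' * b) b]) S i
  else setT.

Let mI (r : seq nat) : measurable (\bigcap_(i in [set` r]) S i).
Proof. exact: fin_bigcap_measurable. Qed.

Let mN n : measurable (no_run n).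
Proof. by elim: n => //= n IH; exact: measurableD. Qed.

Let q := (1 - p ^+ b)%R.

(** The events [S i], [i] in [r], after the first [n] blocks only serve the
    induction, which peels off one block by taking a difference. *)
Let prob_no_run n (r : seq nat) : uniq r -> (forall i, i \in r -> (n * b <= i)%N) ->
  P (\bigcap_(i in [set` r]) S i `&` no_run n) = (p ^+ size r * q ^+ n)%:E.
Proof.
elim: n r => [|n IH] r ur rn.
  by rewrite setIT PS// expr0 mulr1.
have ub : uniq (r ++ iota (n * b) b).
  rewrite cat_uniq ur iota_uniq andbT; apply/hasPn => i.
  rewrite mem_iota -mulSnr => /andP[_ ib]; apply: contraL ib => /rn.
  by rewrite -leqNgt.
have rn' i : i \in r -> (n * b <= i)%N.
  by move=> /rn; apply: leq_trans; rewrite leq_mul2r leqnSn orbT.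
rewrite /= setIDA; set B := \bigcap_(i in [set` iota _ _]) S i.
set A := \bigcap_(i in [set` r]) S i.
transitivity (P (A `&` no_run n) - P (A `&` B `&` no_run n)).
  have mAN : measurable (A `&` no_run n) by exact: (measurableI _ _ (mI _) (mN _)).
  rewrite [A `&` B `&` _]setIAC; apply: (measureD mAN (mI _)).
  by apply: le_lt_trans (ltry 1%R); exact: (probability_le1 P mAN).
rewrite IH// /A /B.
have -> : \bigcap_(i in [set` r]) S i `&` \bigcap_(i in [set` iota (n * b) b]) S i =
    \bigcap_(i in [set` r ++ iota (n * b) b]) S i.
  by rewrite !bigcap_seq big_cat.
rewrite IH//; last first.
  by move=> i; rewrite mem_cat => /orP[/rn'//|]; rewrite mem_iota => /andP[].
rewrite size_cat size_iota exprD -EFinB exprS /q; congr EFin.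
by rewrite mulrBl mul1r mulrBr mulrA.
Qed.

Let q01 : (0 <= q < 1)%R.
Proof.
rewrite /q subr_ge0 gtrBl exprn_gt0// andbT exprn_ile1 ?(ltW p0)//.
have := PS (r := [:: 0%N]) isT; rewrite bigcap_seq big_seq1 /= expr1 => pE.
by rewrite -lee_fin -pE probability_le1.
Qed.

(** Cut time into disjoint blocks of length [b]. The number of blocks up to the
    first successful one dominates [T / b], and it is the sum over [n] of the
    indicators that the first [n] blocks fail, whose probabilities are a
    geometric sequence. *)
Lemma run_waiting_time (T : W -> \bar R) : (forall w, 0 <= T w) ->
  (forall w m, (forall i, (m * b <= i < m.+1 * b)%N -> S i w) ->
     T w <= (m.+1 * b)%:R%:E) ->
  \int[P]_w T w < +oo.
Proof.
move=> T0 TS.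
pose u n w := b%:R%:E * (\1_(no_run n) w)%:E : \bar R.
have u0 n w : 0 <= u n w by rewrite mule_ge0// lee_fin.
have usum w N : (forall n, (n < N)%N -> no_run n w) ->
    (N * b)%:R%:E <= \sum_(n <oo) u n w.
  move=> wN; apply: (@le_trans _ _ (\sum_(0 <= n < N) u n w)); last first.
    exact: nneseries_lim_ge.
  rewrite (@eq_big_nat _ _ _ _ _ _ (fun=> b%:R%:E)); last first.
    by move=> n /andP[_ nN]; rewrite /u indicE mem_set ?mule1//; exact: wN.
  by rewrite sumEFin sumr_const_nat subn0 -mulrnA mulnC.
have Tu w : T w <= \sum_(n <oo) u n w.
  pose run m := `[< forall i, (m * b <= i < m.+1 * b)%N -> S i w >].
  have no_runE n : (forall m, (m < n)%N -> ~~ run m) -> no_run n w.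
    elim: n => //= n IH norun; split; first by apply: IH => m /ltnW; exact: norun.
    move=> runn; have /negP := norun n (ltnSn n); apply; apply/asboolP => i inb.
    by apply: runn; rewrite /= mem_iota -mulSnr.
  have [run_ex|norun] := pselect (exists m, run m).
    case: (ex_minnP run_ex) => m /asboolP mrun mmin.
    apply: le_trans (TS w m mrun) (usum w m.+1 _) => n nm.
    apply: no_runE => k kn; apply/negP => /mmin.
    by rewrite leqNgt (leq_trans kn).
  have allN n : no_run n w.
    by apply: no_runE => m _; apply/negP => mrun; apply: norun; exists m.
  suff -> : \sum_(n <oo) u n w = +oo by rewrite leey.
  apply/eqyP => A A0; apply: le_trans (usum w (Num.bound A) _) => //.
  rewrite lee_fin (le_trans (ltW (archi_boundP (ltW A0))))// ler_nat.
  by rewrite leq_pmulr.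
apply: (@le_lt_trans _ _ (\int[P]_w \sum_(n <oo) u n w)).
  by apply: le_integral_nonneg.
have mu n : measurable_fun setT (u n).
  by apply: emeasurable_funM => //; apply/measurable_EFinP.
rewrite integral_nneseries//.
have intu n : \int[P]_w u n w = (b%:R * q ^+ n)%:E.
  rewrite ge0_integralZl//; last exact/measurable_EFinP.
  rewrite integral_indic// setIT EFinM; congr (_ * _).
  have := @prob_no_run n [::] isT.
  by rewrite bigcap_seq big_nil setTI expr0 mul1r; apply.
under eq_eseriesr do rewrite intu.
have := q01 => /andP[q0 q1].
apply: (@le_lt_trans _ _ (b%:R / (1 - q))%:E); last exact: ltry.
apply: lime_le.
  apply: is_cvg_nneseries => n _ _; rewrite lee_fin mulr_ge0 ?exprn_ge0//.
apply: nearW => n; rewrite sumEFin lee_fin -mulr_sumr ler_wpM2l//.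
rewrite -[leRHS]mul1r ler_pdivlMr ?subr_gt0//.
have -> : ((\sum_(0 <= i < n) q ^+ i) * (1 - q) = 1 - q ^+ n)%R.
  rewrite mulrC -{2}(expr1n _ n) subrXX; congr (_ * _)%R.
  by rewrite big_mkord; apply: eq_bigr => i _; rewrite expr1n mul1r.
by rewrite gerBl exprn_ge0.
Qed.

End RunWaitingTime.

(** * The first honest alarm without a change *)

Section Crossing.
Context (R : realType) (d d' : measure_display).
Context (E : measurableType d) (W : measurableType d').
Variables (lam : {sigma_finite_measure set E -> \bar R}) (f g : E -> R).
Variables (K : nat) (N : {set 'I_K}) (X : 'I_K -> nat -> W -> E).
Hypotheses (df : is_density lam f) (dg : is_density lam g).
Hypothesis KL : (0 < KL_information lam f g < +oo)%E.
Hypothesis mX : forall k t, k \in N -> (0 < t)%N -> measurable_fun setT (X k t).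

Let f0 x : (0 <= f x)%R. Proof. by have [_ f0 _] := df; exact: f0. Qed.
Let g0 x : (0 <= g x)%R. Proof. by have [_ g0 _] := dg; exact: g0. Qed.
Let mf : measurable_fun setT f. Proof. by have [] := df. Qed.
Let mg : measurable_fun setT g. Proof. by have [] := dg. Qed.
Let mfE D : measurable_fun D (fun x => (f x)%:E).
Proof. by apply/measurable_EFinP; exact: measurable_funTS. Qed.

Let mllr : measurable_fun setT (llr f g). Proof. exact: measurable_llr. Qed.

Let mge (c : \bar R) : measurable [set x | c <= llr f g x].
Proof. by rewrite -[X in measurable X]setTI; exact: emeasurable_fun_c_infty. Qed.

Let mle (c : \bar R) : measurable [set x | llr f g x <= c].
Proof. by rewrite -[X in measurable X]setTI; exact: emeasurable_fun_infty_c. Qed.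

(** Some level [c = 1 / (n + 1)] has positive probability as their union does. *)
Lemma llr_ge_prob : exists2 c : R, (0 < c)%R &
  0 < \int[lam]_(x in [set x | c%:E <= llr f g x]) (f x)%:E.
Proof.
apply: contrapT => no_c.
have fE0 x : 0 <= (f x)%:E by rewrite lee_fin.
pose mu : {measure set E -> \bar R} := weighted lam fE0 (@mfE setT).
have := llr_pos_prob df dg KL; apply/negP.
rewrite -leNgt; pose C n := [set x | (n.+1%:R^-1)%:E <= llr f g x].
have -> : [set x | 0 < llr f g x] = \bigcup_n C n.
  apply/seteqP; split => x /=; last first.
    by move=> [n _]; apply: lt_le_trans; rewrite lte_fin invr_gt0.
  case lE : (llr f g x) => [r| |]//; last first.
    by move=> _; exists 0%N => //; rewrite /C /= lE leey.
  rewrite lte_fin => r0; exists (Num.bound r^-1) => //; rewrite /C /= lE lee_fin.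
  rewrite -[leRHS]invrK lef_pV2 ?posrE ?invr_gt0//.
  apply: (le_trans (ltW (archi_boundP _))); first by rewrite invr_ge0 ltW.
  by rewrite ler_nat.
have mC n : measurable (C n) by exact: mge.
rewrite le_eqVlt; apply/orP; left; apply/eqP.
have : mu.-negligible (\bigcup_n C n).
  apply: negligible_bigcup => n; apply/(negligibleP _ (mC n)).
  apply/eqP; rewrite eq_le measure_ge0 andbT leNgt; apply/negP => Cn.
  by apply: no_c; exists n.+1%:R^-1%R => //; rewrite invr_gt0.
by move/(negligibleP _ (bigcupT_measurable _ mC)).
Qed.

Lemma le_cusum_run (x : nat -> E) (c : R) t n :
  (forall s, (t < s <= t + n)%N -> c%:E <= llr f g (x s)) ->
  (n%:R * c)%:E <= cusum f g x (t + n).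
Proof.
elim: n => [|n IH] xc; first by rewrite mul0r cusum_ge0.
rewrite addnS /= le_max; apply/orP; left.
rewrite -natr1 mulrDl mul1r EFinD leeD//.
  by apply: IH => s /andP[ts sn]; rewrite xc// ts addnS ltnW.
by rewrite xc// addnS ltnS leq_addr leqnn.
Qed.

Lemma first_honest_alarm_integrable P h j : honest_law lam f g N X (@no_change K) P ->
  j \in N -> \int[P]_w first_honest_alarm f g N h (fun k s => X k s w) < +oo.
Proof.
move=> lawP jN; have [c c0 pc] := llr_ge_prob.
set C := [set x | _] in pc.
have mC : measurable C by exact: mge.
have pfin : \int[lam]_(x in C) (f x)%:E \is a fin_num.
  rewrite ge0_fin_numE; last by apply: integral_ge0 => x _; rewrite lee_fin.
  apply: le_lt_trans (ltry 1%R); have [_ _ <-] := df.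
  by apply: ge0_subset_integral => // x _; rewrite lee_fin.
pose p := fine (\int[lam]_(x in C) (f x)%:E).
pose S i := X j i.+1 @^-1` C.
pose b := (Num.bound `|h / c|%R).+1.
apply: (@run_waiting_time _ _ _ P S p b) => //.
- move=> i; rewrite -[X in measurable X]setTI; exact: mX.
- move=> r ur; pose s := [seq (j, i.+1) | i <- r].
  have -> : \bigcap_(i in [set` r]) S i = cylinder X s (fun=> C).
    by rewrite /cylinder !bigcap_seq big_map.
  rewrite (prob_cylinder lawP)//.
  + rewrite big_map /density_at /= (eq_bigr (fun=> p%:E)); last first.
      by move=> i _; rewrite fineK.
    by rewrite prodEFin big_const_seq count_predT iter_mulr_1.
  + by rewrite map_inj_uniq// => a a' [].
  + by apply/allP => _ /mapP[i _ ->]; rewrite /honest_coord jN.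
- by rewrite fine_gt0// pc /= -ge0_fin_numE// ltW.
- by move=> w; exact: first_time_ge0.
- move=> w m run; apply: first_time_le => //; exists j => //.
  rewrite mulSnr; apply: le_trans (le_cusum_run (c := c) _).
    rewrite lee_fin -ler_pdivrMr// /b -natr1.
    by rewrite (le_trans (ler_norm _))// (le_trans (ltW (archi_boundP _)))// lerDl.
  move=> s /andP[ms sm]; case: s ms sm => // s ms sm; apply: run.
  by rewrite -ltnS ms mulSnr.
Qed.

Let path k t : seq ('I_K * nat) := [seq (k, s) | s <- iota 1 t].

Let mem_path k t i : (i \in path k t) = (i.1 == k) && (0 < i.2 <= t)%N.
Proof.
case: i => k' s; apply/mapP/idP => [[u]|/= /andP[/eqP-> /andP[s0 st]]].
  by rewrite mem_iota add1n ltnS => ut [-> ->]; rewrite eqxx.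
by exists s => //; rewrite mem_iota s0 add1n ltnS.
Qed.

Let path_uniq k t : uniq (path k t).
Proof. by rewrite map_inj_uniq ?iota_uniq// => a b []. Qed.

Definition stops_short j t (h' h : R) :=
  [set w | h'%:E <= cusum f g (fun s => X j s w) t] `&`
  \bigcap_(s in [set s | (0 < s <= t)%N])
    [set w | cusum f g (fun s' => X j s' w) s < h%:E].

Let stops_short_sigma j t h' h : j \in N ->
  <<s cylinders X (path j t) >> (stops_short j t h' h).
Proof.
move=> jN; pose G := cylinders X (path j t).
pose U s : g_sigma_algebraType G -> E := X j s.
have mU s : (0 < s <= t)%N -> measurable_fun setT (U s).
  move=> st _ C mC; rewrite setTI; apply: sub_sigma_algebra.
  pose A (i : 'I_K * nat) := if i == (j, s) then C else setT.
  exists A; first by move=> i _; rewrite /A; case: ifP.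
  apply/seteqP; split => w.
    move=> /= wC [k u] /= _; rewrite /A; case: eqP => // -[-> ->] //.
  move=> /(_ (j, s)); rewrite /A eqxx; apply.
  by rewrite /= mem_path eqxx.
have mcus s : (s <= t)%N -> measurable_fun setT
    (fun w : g_sigma_algebraType G => cusum f g (U^~ w) s).
  move=> st; apply: measurable_cusum => // u /andP[u0 us].
  by apply: mU; rewrite u0 (leq_trans us).
have -> : stops_short j t h' h = [set w | h'%:E <= cusum f g (U^~ w) t] `&`
  \bigcap_(s in [set s | (0 < s <= t)%N]) [set w | cusum f g (U^~ w) s < h%:E] by [].
have m1 : measurable [set w : g_sigma_algebraType G | h'%:E <= cusum f g (U^~ w) t].
  rewrite -[X in measurable X]setTI; apply: emeasurable_fun_c_infty => //.
  exact: mcus.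
have m2 : measurable (\bigcap_(s in [set s | (0 < s <= t)%N])
    [set w : g_sigma_algebraType G | cusum f g (U^~ w) s < h%:E]).
  apply: bigcap_measurableType => s /andP[_ st].
  rewrite -[X in measurable X]setTI; apply: emeasurable_fun_infty_o => //.
  exact: mcus.
exact: measurableI m1 m2.
Qed.

(** If the local statistic of [j] could jump past [h'] without reaching [h]
    while the other honest sensors stay silent, the two first alarms would
    differ. Silence has positive probability without a change and is independent
    of the observations of [j], whose law with a change is absolutely continuous
    with respect to the one without. *)
Lemma stops_short_null P Q c h' h j t : honest_law lam f g N X (@no_change K) P ->
  honest_law lam f g N X c Q -> (0 < h')%R -> (h' <= h)%R ->
  \int[P]_w first_honest_alarm f g N h (fun k s => X k s w) <=
    \int[P]_w first_honest_alarm f g N h' (fun k s => X k s w) ->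
  j \in N -> (0 < t)%N -> Q (stops_short j t h' h) = 0.
Proof.
move=> lawP lawQ h'0 hh Ehh jN t0.
have h0 : (0 < h)%R by exact: lt_le_trans hh.
pose mn h w := first_honest_alarm f g N h (fun k s => X k s w).
have mmn y : measurable_fun setT (mn y) by exact: measurable_first_honest_alarm.
have neg : P.-negligible [set w | setT w /\ mn h' w <> mn h w].
  apply: eq_integral_null => //.
  - by move=> w _; exact: first_time_ge0.
  - by move=> w _; exact: le_first_honest_alarm.
  - exact: first_honest_alarm_integrable jN.
pose s0 := path j t.
pose r := [seq (k, s) | k <- enum (N :\ j), s <- iota 1 t].
have rP i : (i \in r) = [&& i.1 != j, i.1 \in N & (0 < i.2 <= t)%N].
  apply/allpairsP/idP => [[[k s] /= [+ + ->]]|].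
    by rewrite mem_enum !inE mem_iota add1n ltnS /= => /andP[-> ->].
  case: i => k s /= /and3P[kj kN st]; exists (k, s).
  by rewrite mem_enum !inE mem_iota add1n ltnS kj kN st.
have ur : uniq r.
  by apply: allpairs_uniq; rewrite ?enum_uniq ?iota_uniq// => -[? ?] [? ?].
have usr : uniq (s0 ++ r).
  rewrite cat_uniq path_uniq ur andbT /=; apply/hasPn => i.
  by rewrite rP mem_path => /andP[/negbTE->].
have s0D : all (honest_coord N) s0.
  by apply/allP => i; rewrite mem_path /honest_coord => /and3P[/eqP-> -> _]; rewrite jN.
have rD : all (honest_coord N) r.
  by apply/allP => i; rewrite rP /honest_coord => /and4P[_ -> ->].
have srD : all (honest_coord N) (s0 ++ r) by rewrite all_cat s0D.
pose A := fun _ : 'I_K * nat => [set x | llr f g x <= 0].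
have mA i : i \in r -> measurable (A i) by move=> _; exact: mle.
pose D := stops_short j t h' h.
have mD : measurable D.
  by apply: (measurable_sigma (cylinders_measurable mX s0D)); exact: stops_short_sigma.
have mDG : measurable (D `&` cylinder X r A).
  exact: (measurableI _ _ mD (measurable_cylinder mX rD mA)).
have PD : P (D `&` cylinder X r A) = 0.
  apply/(negligibleP _ mDG); apply: negligibleS neg => w [[wt ws] wr].
  split => // E0.
  have le_t : mn h' w <= t%:R%:E by apply: first_time_le => //; exists j.
  have : t.+1%:R%:E <= mn h w.
    apply: le_first_time => s s0' [k kN hk]; rewrite lee_fin ler_nat ltnNge.
    apply/negP => st; move: hk; apply/negP; rewrite -ltNge.
    have [->|kj] := eqVneq k j; first by apply: ws; rewrite /= s0'.
    rewrite cusum_eq0// ?lte_fin// => u /andP[u0 us].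
    have /(_ _) := wr (k, u); apply.
    by rewrite /= rP /= kj kN u0 (leq_trans us).
  rewrite -E0 => /le_trans/(_ le_t); rewrite lee_fin ler_nat.
  by rewrite ltnn.
(* Only the observations of [j] change law, so that silence keeps its
   probability. *)
pose s1 := [seq i <- s0 | c i.1 i.2].
have s1D : all (honest_coord N) s1.
  by apply/allP => i; rewrite mem_filter => /andP[_ si]; exact: (allP s0D).
have [Q1 [law1 ac1]] := change_coords df dg KL mX lawP s1D.
have c1 : {in s0, forall i, ((i.1, i.2) \in s1) = c i.1 i.2}.
  by move=> i si; rewrite mem_filter -surjective_pairing si andbT.
have E0 := transfer_law (A := A) mX law1 lawQ c1 usr srD mA (stops_short_sigma h' h jN).
have G0 : 0 < Q1 (cylinder X r A).
  rewrite (prob_cylinder law1)// big_seq.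
  apply: (big_ind (fun y => 0 < y)) => [|y z|[k s] kr]; first by rewrite lte_fin.
    exact: mule_gt0.
  rewrite /density_at /= ifN; first exact: llr_nonpos_prob.
  move: kr; rewrite rP mem_filter mem_path => /and3P[/= kj _ _].
  by rewrite (negbTE kj) andbF.
have Q1D : Q1 (D `&` cylinder X r A) = 0 by exact: ac1.
move: E0; rewrite Q1D => /esym/eqP.
by rewrite mule_eq0 gt_eqF//= => /eqP.
Qed.

End Crossing.

(** * Two strategies of the adversary *)

Section Strategies.
Context (R : realType) (d : measure_display) (E : measurableType d).
Variables (f g : E -> R) (K : nat) (N : {set 'I_K}).
Hypothesis mllr : measurable_fun setT (llr f g).
Implicit Types (x : 'I_K -> nat -> E) (e : E) (pi : strategy E N).

Definition constant_strategy e : strategy E N :=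
  @Strategy _ E _ N (fun t k u => e) (fun t k => measurable_cst e).

Definition leader e (s : seq E) : E :=
  foldr (fun y z => if llr f g z <= llr f g y then y else z) e s.

Lemma llr_leader e s y : y \in s -> llr f g y <= llr f g (leader e s).
Proof.
elim: s => //= z s IH; rewrite inE; case: ifPn => [zs|]; last first.
  by rewrite -ltNge => /ltW zs /predU1P[->//|/IH].
by move=> /predU1P[->//|/IH ys]; exact: le_trans zs.
Qed.

Lemma measurable_leader (d' : measure_display) (W : measurableType d') e
    (I : Type) (u : I -> W -> E) (s : seq I) :
  (forall i, measurable_fun setT (u i)) ->
  measurable_fun setT (fun w => leader e [seq u i w | i <- s]).
Proof.
move=> mu; elim: s => [|i s IH] //=.
by apply: measurable_fun_ifT => //; apply: measurable_fun_lee;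
  apply: (measurableT_comp mllr).
Qed.

(** The row [ord_max] of the history is the one of time [t]; the history of time
    [0] has no row, whence the default value. *)
Definition greedy_act e t (k : 'I_K) : t.-tuple (#|N|.-tuple E) -> E :=
  if t is t'.+1 then fun u => leader e (tnth u ord_max) else fun=> e.

Lemma measurable_greedy_act e t k : measurable_fun setT (@greedy_act e t k).
Proof.
case: t => [|t] /=; first exact: measurable_cst.
apply: (measurableT_comp (f := fun v : #|N|.-tuple E => leader e v)); last first.
  exact: measurable_tnth.
have -> : (fun v : #|N|.-tuple E => leader e v) =
    fun v => leader e [seq tnth v i | i <- enum 'I_#|N|].
  by apply/funext => v; rewrite map_tnth_enum.
apply: (@measurable_leader _ _ _ _ (fun i (v : #|N|.-tuple E) => tnth v i)) => i.
exact: measurable_tnth.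
Qed.

Definition greedy_strategy e : strategy E N :=
  Strategy (measurable_greedy_act e).

Lemma observed_honest pi x k : k \in N -> observed pi x k = x k.
Proof. by move=> kN; apply/funext => t; rewrite /observed kN. Qed.

Lemma first_honest_alarm_observed h pi x :
  first_honest_alarm f g N h (observed pi x) = first_honest_alarm f g N h x.
Proof.
apply/eqP; rewrite eq_le; apply/andP; split; apply: sub_first_time => t _ [j jN].
  by exists j; rewrite ?observed_honest.
by rewrite observed_honest//; exists j.
Qed.

Lemma joint_honest_alarm_observed h pi x :
  joint_honest_alarm f g N h (observed pi x) = joint_honest_alarm f g N h x.
Proof.
apply/eqP; rewrite eq_le; apply/andP; split; apply: sub_first_time => t _ ht j jN.
  by rewrite observed_honest// ht.
by have := ht j jN; rewrite observed_honest.
Qed.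

Lemma sum_honest_alarm_observed h pi x :
  sum_honest_alarm f g N h (observed pi x) = sum_honest_alarm f g N h x.
Proof.
congr first_time; apply/funext => t.
suff -> : \sum_(j in N) cusum f g (observed pi x j) t =
  \sum_(j in N) cusum f g (x j) t by [].
by apply: eq_bigr => j jN; rewrite (observed_honest pi x jN).
Qed.

(** By induction, as the increment of a corrupt statistic is the largest of the
    honest increments. *)
Lemma greedy_leads e x k j t : k \notin N -> j \in N ->
  cusum f g (observed (greedy_strategy e) x j) t <=
  cusum f g (observed (greedy_strategy e) x k) t.
Proof.
move=> kN jN; apply: le_cusum => -[//|s] _.
rewrite observed_honest// /observed (negbTE kN) /=.
apply: llr_leader; rewrite tnth_mktuple.
apply/mapP; exists (enum_rank_in jN j); first by rewrite mem_enum.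
by rewrite enum_rankK_in.
Qed.

Lemma constant_silent e x k t : llr f g e <= 0 -> k \notin N ->
  cusum f g (observed (constant_strategy e) x k) t = 0.
Proof. by move=> e0 kN; apply: cusum_eq0 => s _; rewrite /observed (negbTE kN). Qed.

End Strategies.

(** * The filtration *)

Section Observations.
Context (d d' : measure_display) (E : measurableType d) (W : measurableType d').
Variables (K : nat) (N : {set 'I_K}) (X : 'I_K -> nat -> W -> E) (t : nat).
Hypothesis mX : forall k s, k \in N -> (0 < s <= t)%N -> measurable_fun setT (X k s).

Lemma measurable_observations (pi : strategy E N) k s : (0 < s <= t)%N ->
  measurable_fun setT (fun w => observations X pi w k s).
Proof.
move=> st; have [kN|kN] := boolP (k \in N).
  rewrite [X in measurable_fun _ X](_ : _ = X k s); first exact: mX.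
  by apply/funext => w; rewrite /observations observed_honest.
rewrite /observations /observed (negbTE kN).
apply: (measurableT_comp (@act_measurable _ _ _ _ pi s k)).
apply/measurable_fun_tnthP => i; apply/measurable_fun_tnthP => j.
rewrite [X in measurable_fun _ X](_ : _ = X (enum_val j) i.+1).
  apply: mX; first exact: enum_valP.
  by case/andP: st => _; exact: leq_trans.
by apply/funext => w /=; rewrite !tnth_mktuple.
Qed.

End Observations.

Section Filtration.
Context (d d' : measure_display) (E : measurableType d) (W : measurableType d').
Variables (K : nat) (N : {set 'I_K}) (X : 'I_K -> nat -> W -> E).
Hypothesis mX : forall k s, k \in N -> (0 < s)%N -> measurable_fun setT (X k s).
Implicit Types pi : strategy E N.

Lemma filtration_measurable pi t : filtration X pi t `<=` measurable.
Proof.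
apply: smallest_sub; first exact: sigma_algebra_measurable.
move=> _ [k [s [C [st mC ->]]]]; rewrite -[X in measurable X]setTI.
apply: (@measurable_observations _ _ _ _ _ _ _ t) => // j u jN /andP[u0 _].
exact: mX.
Qed.

(** The corrupt observations are functions of the honest ones, so that the
    information available at time [t] does not depend on the adversary. *)
Lemma sub_filtration pi pi' t : filtration X pi t `<=` filtration X pi' t.
Proof.
apply: smallest_sub; first exact: smallest_sigma_algebra.
move=> _ [k [s [C [st mC ->]]]].
rewrite /filtration; set G := [set A | _].
pose U j u : g_sigma_algebraType G -> E := X j u.
have mU j u : j \in N -> (0 < u <= t)%N -> measurable_fun setT (U j u).
  move=> jN ut _ D mD; rewrite setTI; apply: sub_sigma_algebra.
  exists j, u, D; split => //; apply/seteqP.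
  by split => w /=; rewrite /observations observed_honest.
have := measurable_observations mU pi k st.
by move=> /(_ measurableT _ mC); rewrite setTI.
Qed.

Lemma filtration_sigma pi t : filtration X pi t = <<s filtration X pi t >>.
Proof. exact/esym/sigma_algebra_id/smallest_sigma_algebra. Qed.

End Filtration.

(** * Bounds on the two criteria *)

Section Criteria.
Context (R : realType) (d d' : measure_display).
Context (E : measurableType d) (W : measurableType d').
Variables (K : nat) (N : {set 'I_K}) (X : 'I_K -> nat -> W -> E).
Hypothesis mX : forall k s, k \in N -> (0 < s)%N -> measurable_fun setT (X k s).
Implicit Types (S T U : rule R E K) (pi : strategy E N).

Lemma time_to_false_alarm_eq (Pinf : probability W R) T U pi0 :
  (forall x, 0 <= U x) -> (forall pi x, U x <= T (observed pi x)) ->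
  (forall x, T (observed pi0 x) = U x) ->
  time_to_false_alarm N X Pinf T = \int[Pinf]_w U (fun k s => X k s w).
Proof.
move=> U0 UT T0; apply/eqP; rewrite eq_le; apply/andP; split.
  apply: ereal_inf_lbound; exists pi0 => //.
  by apply: eq_integral => w _; rewrite /observations T0.
apply/ereal_infP => _ [pi _ <-].
by apply: le_integral_nonneg => // w; exact: UT.
Qed.

(** All the strategies generate the same filtration, so that conditioning does
    not see the strategy: it is enough that [S] under the single strategy [pi0]
    almost surely stops no earlier than [T] under any strategy. *)
Lemma le_delay (P : nat -> {set 'I_K} -> probability W R) (B : {set 'I_K}) S T pi0 :
  measurable_fun setT (fun w => S (observations X pi0 w)) ->
  (forall nu, exists2 A, measurable A & P nu B A = 0 /\
     forall pi w, ~ A w -> T (observations X pi w) <= S (observations X pi0 w)) ->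
  delay N X P B T <= delay N X P B S.
Proof.
move=> mS TS; apply/ge_ereal_sup => _ [nu [pi [Z [ZP ->]]]].
have [A mA [PA TSA]] := TS nu.
pose late (V : rule R E K) (p : strategy E N) w : \bar R :=
  maxe (V (observations X p w) - nu%:R%:E) 0.
have late0 V p w : 0 <= late V p w by rewrite /late le_max lexx orbT.
have mlate : measurable_fun setT (late S pi0).
  by apply: measurable_maxe => //; exact: emeasurable_funB.
have FE : filtration X pi0 nu = filtration X pi nu.
  by apply/seteqP; split; exact: sub_filtration.
have mF := filtration_measurable mX (pi := pi0) (t := nu).
have [Z' Z'P] := cond_exp_exists (P nu B) mF mlate (late0 S pi0).
apply: (@le_trans _ _ (ess_sup (P nu B) Z')); last first.
  by apply: ereal_sup_ubound; exists nu, pi0, Z'.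
apply: le_ess_sup; rewrite -FE in ZP.
have : (P nu B).-negligible [set w | Z' w < Z w].
  apply: (le_cond_exp mF (filtration_sigma _ _ _) ZP Z'P) => C FC.
  have mC := mF _ FC.
  pose Y w := if w \in A then +oo else late S pi0 w.
  have mY : measurable_fun setT Y.
    apply: measurable_fun_ifT => //; apply: (measurable_fun_bool true).
    rewrite setTI [X in measurable X](_ : _ = A)//.
    by apply/seteqP; split => w; [exact: set_mem|exact: mem_set].
  rewrite -[leRHS](@ge0_ae_eq_integral _ _ _ _ _ Y)//.
  - apply: le_integral_nonneg => [w|w]; first exact: late0.
    rewrite /Y; case: ifPn => [_|]; first by rewrite leey.
    rewrite notin_setE => nAw; rewrite /late ge_max !le_max lexx orbT andbT.
    by rewrite leeB// TSA.
  - exact: measurable_funTS.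
  - exact: measurable_funTS.
  - by move=> w _; rewrite /Y; case: ifP.
  - exists A; split => // w /= Yw; apply: contrapT => nAw; apply: Yw => _.
    by rewrite /Y ifN// notin_setE.
by apply: negligibleS => w /= /negP; rewrite -ltNge.
Qed.

End Criteria.

(** * Comparison of the three rules *)

Section Main.
Context (R : realType) (d d' : measure_display).
Context (E : measurableType d) (W : measurableType d').
Variables (lam : {sigma_finite_measure set E -> \bar R}) (f g : E -> R).
Variables (K M : nat) (N : {set 'I_K}) (X : 'I_K -> nat -> W -> E).
Variables (Pinf : probability W R) (P : nat -> {set 'I_K} -> probability W R).
Hypotheses (df : is_density lam f) (dg : is_density lam g).
Hypothesis KL : (0 < KL_information lam f g < +oo)%E.
Hypotheses (NE : #|N| = M.+1) (KE : K = (M + M.+1)%N).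
Hypothesis mX : forall k t, k \in N -> (0 < t)%N -> measurable_fun setT (X k t).
Hypothesis lawPinf : honest_law lam f g N X (@no_change K) Pinf.
Hypothesis lawP : forall (nu : nat) (B : {set 'I_K}), B \subset N ->
  honest_law lam f g N X (change_at nu B) (P nu B).
Implicit Types (h : R) (S T : rule R E K).

Let f0 x : (0 <= f x)%R. Proof. by have [_ f0 _] := df; exact: f0. Qed.
Let g0 x : (0 <= g x)%R. Proof. by have [_ g0 _] := dg; exact: g0. Qed.
Let mf : measurable_fun setT f. Proof. by have [] := df. Qed.
Let mg : measurable_fun setT g. Proof. by have [] := dg. Qed.
Let mllr : measurable_fun setT (llr f g). Proof. exact: measurable_llr. Qed.

Let far := time_to_false_alarm N X Pinf.
Let dom := dominates M N X Pinf P.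
Let tau := Lth_alarm f g (K := K) (M + 1).
Let vote := voting f g (K := K) (M + 1).
Let lowsum := low_sum_cusum f g (K := K) (M + 1).
Let honest w : 'I_K -> nat -> E := fun k s => X k s w.

Let dominatesP S T : delay N X P N S <= delay N X P N T -> dom S T.
Proof.
move=> ST _ B BN /andP[MB _].
suff -> : B = N by [].
by apply/eqP; rewrite eqEcard BN NE -addn1.
Qed.

(** As both densities have mass one, [g] cannot be above [f] everywhere. *)
Let silent_observation : exists e, llr f g e <= 0.
Proof.
apply: contrapT => no_e; have := llr_nonpos_prob df dg KL.
rewrite (_ : [set x | _] = set0) ?integral_set0 ?ltxx//.
by rewrite -subset0 => x xle; apply: no_e; exists x.
Qed.

(** No alarm comes before the first honest one, as a majority contains an honest
    sensor; the greedy strategy completes the majority at this time. *)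
Let far_vote h : far (vote h) = \int[Pinf]_w first_honest_alarm f g N h (honest w).
Proof.
have [e _] := silent_observation.
apply: (@time_to_false_alarm_eq _ _ _ _ _ _ _ _ _ _ _ (greedy_strategy N mllr e)).
- by move=> x; exact: first_time_ge0.
- move=> pi x; rewrite -(first_honest_alarm_observed f g h pi).
  by apply: (@le_trans _ _ (tau h (observed pi x)));
    [exact: first_honest_alarm_le_Lth_alarm|exact: Lth_alarm_le_voting].
- move=> x; rewrite -(first_honest_alarm_observed f g h (greedy_strategy N mllr e)).
  apply: voting_leading => // k j t; exact: greedy_leads.
Qed.

Let far_tau h : far (tau h) = \int[Pinf]_w first_honest_alarm f g N h (honest w).
Proof.
have [e _] := silent_observation.
apply: (@time_to_false_alarm_eq _ _ _ _ _ _ _ _ _ _ _ (greedy_strategy N mllr e)).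
- by move=> x; exact: first_time_ge0.
- move=> pi x; rewrite -(first_honest_alarm_observed f g h pi).
  exact: first_honest_alarm_le_Lth_alarm.
- move=> x; rewrite -(first_honest_alarm_observed f g h (greedy_strategy N mllr e)).
  apply/eqP; rewrite eq_le first_honest_alarm_le_Lth_alarm// andbT.
  rewrite -(voting_leading NE KE (M := M))//; first exact: Lth_alarm_le_voting.
  by move=> k j t; exact: greedy_leads.
Qed.

Let far_lowsum h : far (lowsum h) = \int[Pinf]_w sum_honest_alarm f g N h (honest w).
Proof.
have [e _] := silent_observation.
apply: (@time_to_false_alarm_eq _ _ _ _ _ _ _ _ _ _ _ (greedy_strategy N mllr e)).
- by move=> x; exact: first_time_ge0.
- move=> pi x; rewrite -(sum_honest_alarm_observed f g h pi).
  exact: sum_honest_alarm_le_low_sum.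
- move=> x; rewrite -(sum_honest_alarm_observed f g h (greedy_strategy N mllr e)).
  apply: low_sum_leading => // k j t; exact: greedy_leads.
Qed.

Lemma le_far_vote h h' : (h <= h')%R -> far (vote h) <= far (vote h').
Proof.
move=> hh; rewrite !far_vote; apply: le_integral_nonneg => w.
  exact: first_time_ge0.
exact: le_first_honest_alarm.
Qed.

Lemma le_far_lowsum h h' : (h <= h')%R -> far (lowsum h) <= far (lowsum h').
Proof.
move=> hh; rewrite !far_lowsum; apply: le_integral_nonneg => w.
  exact: first_time_ge0.
exact: le_sum_honest_alarm.
Qed.

Lemma far_lowsum_vote h : far (lowsum h) <= far (vote h).
Proof.
rewrite far_vote far_lowsum; apply: le_integral_nonneg => w.
  exact: first_time_ge0.
exact: sum_honest_alarm_le_first_honest_alarm.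
Qed.

(** The silent strategy lets [S] wait for all the honest sensors, so it is enough
    that no strategy keeps [T] from stopping by then. *)
Let delay_silent S T h' :
  (forall x, (forall k t, k \notin N -> cusum f g (x k) t = 0) ->
    S x = joint_honest_alarm f g N h' x) ->
  (forall nu, exists2 A, measurable A & P nu N A = 0 /\
     forall (pi : strategy E N) w, ~ A w ->
       T (observations X pi w) <= joint_honest_alarm f g N h' (honest w)) ->
  delay N X P N T <= delay N X P N S.
Proof.
move=> Ssil TS; have [e e0] := silent_observation.
have SE w : S (observations X (constant_strategy N e) w) =
    joint_honest_alarm f g N h' (honest w).
  rewrite Ssil ?joint_honest_alarm_observed// => k t kN; exact: constant_silent.
apply: (le_delay mX (pi0 := constant_strategy N e)).
  rewrite [X in measurable_fun _ X](_ : _ =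
    fun w => joint_honest_alarm f g N h' (honest w)).
    exact: measurable_joint_honest_alarm.
  exact/funext.
move=> nu; have [A mA [PA TSA]] := TS nu.
by exists A => //; split => // pi w nA; rewrite SE; exact: TSA.
Qed.

Let delay_pointwise S T h h' : (h <= h')%R ->
  (forall x, (forall k t, k \notin N -> cusum f g (x k) t = 0) ->
    S x = joint_honest_alarm f g N h' x) ->
  (forall x, T x <= joint_honest_alarm f g N h x) ->
  delay N X P N T <= delay N X P N S.
Proof.
move=> hh Ssil Th; apply: (delay_silent Ssil) => nu.
exists set0 => //; split => [|pi w _]; first exact: measure0.
apply: le_trans (Th _) _; rewrite joint_honest_alarm_observed.
exact: le_joint_honest_alarm.
Qed.

Lemma voting_dominates_low_sum h h' : (h <= h')%R -> dom (vote h) (lowsum h').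
Proof.
move=> hh; apply: dominatesP; apply: (delay_pointwise hh) => x.
  by move=> sil; exact: low_sum_silent.
exact: voting_le_joint_honest_alarm.
Qed.

(** For [h' < h] the exceptional event is that the statistic of some honest sensor
    stands between the two thresholds without having reached the larger one.
    Off this event, a sensor whose statistic is above [h'] has alarmed at [h]. *)
Lemma Lth_alarm_dominates_voting h h' : (0 < h')%R ->
  far (tau h) = far (vote h') -> dom (tau h) (vote h').
Proof.
move=> h'0; rewrite far_tau far_vote => hfar; apply: dominatesP.
have Ssil x : (forall k t, k \notin N -> cusum f g (x k) t = 0) ->
    vote h' x = joint_honest_alarm f g N h' x by move=> sil; exact: voting_silent.
have [hh|hh] := leP h h'.
  apply: (delay_pointwise hh Ssil) => x.
  by apply: (@le_trans _ _ (vote h x));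
    [exact: Lth_alarm_le_voting|exact: voting_le_joint_honest_alarm].
apply: (delay_silent Ssil) => nu.
pose A := \bigcup_t \bigcup_(j in [set` enum N]) stops_short f g X j t.+1 h' h.
have mshort j t : j \in N -> measurable (stops_short f g X j t h' h).
  move=> jN; apply: measurableI.
    rewrite -[X in measurable X]setTI; apply: emeasurable_fun_c_infty => //.
    exact: (measurable_honest_cusum f0 g0 mf mg mX).
  apply: bigcap_measurableType => s _.
  rewrite -[X in measurable X]setTI; apply: emeasurable_fun_infty_o => //.
  exact: (measurable_honest_cusum f0 g0 mf mg mX).
have mA : measurable A.
  apply: bigcup_measurable => t _; apply: fin_bigcup_measurable => // j jN.
  by apply: mshort; rewrite -mem_enum.
exists A; [exact: mA|split].
  apply/(negligibleP _ mA).
  apply: negligible_bigcup => t; rewrite bigcup_seq big_seq.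
  apply: (big_ind (fun D => (P nu N).-negligible D)).
  - exact: negligible_set0.
  - by move=> D1 D2; exact: negligibleU.
  move=> j; rewrite mem_enum => jN; apply/(negligibleP _ (mshort j _ jN)).
  apply: (stops_short_null df dg KL mX lawPinf (lawP nu (subxx N)) h'0 (ltW hh)) => //.
  by rewrite hfar.
move=> pi w nA; apply: (Lth_alarm_le NE) => j jN.
rewrite /observations observed_honest//.
apply: le_first_time => t t0 ht; have htj := ht j jN.
have [s /andP[s0 st] hs] : exists2 s, (0 < s <= t)%N & h%:E <= cusum f g (honest w j) s.
  apply: contrapT => nos; apply: nA; case: t t0 ht htj nos => // t t0 ht htj nos.
  exists t => //; exists j; first by rewrite /= mem_enum.
  split => // s st /=.
  by rewrite ltNge; apply/negP => hs; apply: nos; exists s.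
apply: le_trans (first_time_le R s0 hs) _.
by rewrite lee_fin ler_nat.
Qed.

End Main.

Local Close Scope ereal_scope.

(* The value of [far] need not determine the threshold: with discrete
   log-likelihood ratios it is constant on whole ranges of thresholds, on which
   the delay still varies. Comparing [vote h] with [lowsum h'] at one value of
   [far] is then ambiguous, and false for some choices when [h' < h] and both
   thresholds give the voting rule that value. The second half is the
   domination for all other pairs of thresholds, and in general the domination
   of each choice of either rule for a suitable choice of the other one.
   As [K - M = M + 1], the only [B] to which [dominates] applies is [N]. *)
Theorem corollary1 (R : realType) (d d' : measure_display)
    (E : measurableType d) (W : measurableType d')
    (lam : {sigma_finite_measure set E -> \bar R}) (f g : E -> R)
    (K M : nat) (N : {set 'I_K}) (X : 'I_K -> nat -> W -> E)
    (Pinf : probability W R) (P : nat -> {set 'I_K} -> probability W R) :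
  is_density lam f -> is_density lam g ->
  (0 < KL_information lam f g < +oo)%E ->
  (M < K)%N -> #|N| = (K - M)%N ->
  (forall k t, k \in N -> (0 < t)%N -> measurable_fun [set: W] (X k t)) ->
  honest_law lam f g N X (@no_change K) Pinf ->
  (forall (nu : nat) (B : {set 'I_K}), B \subset N ->
     honest_law lam f g N X (change_at nu B) (P nu B)) ->
  (K - M = M + 1)%N ->
  let far := time_to_false_alarm N X Pinf in
  let dom := dominates M N X Pinf P in
  let tau := Lth_alarm f g (K := K) (M + 1) in
  let vote := voting f g (K := K) (M + 1) in
  let lowsum := low_sum_cusum f g (K := K) (M + 1) in
  (forall h h' : R, 0 < h -> 0 < h' ->
     far (tau h) = far (vote h') -> dom (tau h) (vote h')) /\
  (forall h h' : R, 0 < h -> 0 < h' ->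
     far (vote h) = far (lowsum h') ->
     [/\ h <= h' \/ far (vote h') <> far (vote h) ->
           dom (vote h) (lowsum h'),
         exists h1 : R, [/\ 0 < h1, far (vote h1) = far (vote h)
                          & dom (vote h1) (lowsum h')]
       & exists h1 : R, [/\ 0 < h1, far (lowsum h1) = far (lowsum h')
                          & dom (vote h) (lowsum h1)]]).
Proof.
move=> df dg KL MK NE mX lawPinf lawP KM far dom tau vote lowsum.
have NE' : #|N| = M.+1 by rewrite NE KM addn1.
have KE : K = (M + M.+1)%N by rewrite -addn1 -KM subnKC// ltnW.
split=> [h h' h0 h'0|h h' h0 h'0 hfar].
  exact: (Lth_alarm_dominates_voting df dg KL NE' KE mX lawPinf lawP h'0).
have vote_lowsum a b : a <= b -> dom (vote a) (lowsum b).
  exact: (voting_dominates_low_sum P df dg KL NE' KE mX).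
have le_vote a b : a <= b -> (far (vote a) <= far (vote b))%E.
  exact: (le_far_vote X Pinf df dg KL NE' KE).
have le_lowsum a b : a <= b -> (far (lowsum a) <= far (lowsum b))%E.
  exact: (le_far_lowsum X Pinf df dg KL NE').
have lowsum_vote a : (far (lowsum a) <= far (vote a))%E.
  exact: (far_lowsum_vote X Pinf df dg KL NE' KE).
clearbody far dom vote lowsum.
have [hh|/ltW hh] := leP h h'.
  split=> [_||]; first exact: vote_lowsum.
    by exists h; split=> //; exact: vote_lowsum.
  by exists h'; split=> //; exact: vote_lowsum.
(* For [h' <= h] the squeeze
   [far (lowsum h') <= far (vote h') <= far (vote h) = far (lowsum h')]
   forces equalities, so that [h'] is also a threshold for voting; and
   [far (lowsum h') <= far (lowsum h) <= far (vote h)] makes [h] one for the sum. *)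
have voteE : far (vote h') = far (vote h).
  by apply/eqP; rewrite eq_le (le_vote _ _ hh) hfar lowsum_vote.
have lowsumE : far (lowsum h) = far (lowsum h').
  by apply/eqP; rewrite eq_le (le_lowsum _ _ hh) andbT -hfar lowsum_vote.
split.
- by case=> [hh'|//]; exact: vote_lowsum.
- by exists h'; split=> //; exact: vote_lowsum.
- by exists h; split=> //; exact: vote_lowsum.
Qed.
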